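(* Let $R$ be a commutative ring with unit, let $f,g\colon X\to Y$ be continuous maps between path-connected ANR spaces, and let $\theta\colon H^*(-;R)\to H^{*+i}(-;S)$ be a stable cohomology operation with excess $e(\theta)\geq n>0$. If $u\in\mathcal{J}(f,g;R)\cap H^n(X;R)$, then $\theta(u)$ has cohomological weight at least $2$: $$\mathrm{H}^{\bullet}\mathrm{w}(\theta(u);R)\geq 2.$$
   Context: $H^*(-;R)$ denotes singular cohomology; $R$ and $S$ are commutative rings with unit. For continuous maps $p,q\colon A\to Y$, the cohomological distance $\mathrm{H}^{\bullet}\mathrm{D}(p,q;R)$ is the least integer $n\geq 0$ for which there exists an open cover $\{U_0,\dots,U_n\}$ of $A$ such that $(p_{|U_j})^*=(q_{|U_j})^*\colon H^m(Y;R)\to H^m(U_j;R)$ for all $m\geq 0$ and all $j=0,\dots,n$ (the $U_j$ need not be path-connected; the value is $\infty$ if no such $n$ exists). $\mathcal{J}(f,g;R)\subset H^*(X;R)$ denotes the image of $f^*-g^*\colon H^*(Y;R)\to H^*(X;R)$. Cohomological weight (with respect to $f,g$): a nonzero class $v\in H^*(X;S)$ has cohomological weight $\mathrm{H}^{\bullet}\mathrm{w}(v;R)=k+1$ if $k$ is the greatest integer such that, for every path-connected topological space $A$ and every continuous map $\phi\colon A\to X$ with $\mathrm{H}^{\bullet}\mathrm{D}(f\circ\phi,g\circ\phi;R)\leq k$, one has $\phi^*(v)=0\in H^*(A;S)$; the weight is $\infty$ if there is no greatest such $k$. One sets $\mathrm{H}^{\bullet}\mathrm{w}(0;R)=\infty$.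 The ring $R$ in the notation is the coefficient ring used for the cohomological distance. A stable cohomology operation $\theta\colon H^*(-;R)\to H^{*+i}(-;S)$ is a natural transformation that commutes with the suspension isomorphism. The excess $e(\theta)$ is the largest integer $n>0$ such that $\theta(u)=0$ for every space $Z$ and every $u\in H^m(Z;R)$ with $m<n$ (it is $\infty$ if this holds for all $n$). *)

(* Defs.v *)
From HB Require Import structures.
From mathcomp Require Import all_boot all_order all_algebra.
From mathcomp Require Import generic_quotient ring_quotient.
From mathcomp Require Import all_classical all_reals.
From mathcomp Require Import topology normedtype homotopy.

Set Implicit Arguments.
Unset Strict Implicit.
Unset Printing Implicit Defensive.

Import Order.TTheory GRing.Theory Num.Theory numFieldNormedType.Exports.
Local Open Scope classical_set_scope.
Local Open Scope ring_scope.
Local Open Scope quotient_scope.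

(* The real line is an arbitrary [RR : realType]; [RR] is an explicit argument
   of everything below that refers to simplices or paths. *)

Lemma continuous_set_val (X : topologicalType) (U : set X) :
  continuous (set_val : U -> X).
Proof. exact: initial_continuous. Qed.

Definition subspace_incl (X : topologicalType) (U : set X) :
  continuousType U X := mkcts (@continuous_set_val X U).

(** * Singular simplices *)

Definition std_simplex (RR : realType) (m : nat) : set 'rV[RR]_m.+1 :=
  [set t | (forall j, 0 <= t 0 j) /\ \sum_j t 0 j = 1].
Arguments std_simplex : clear implicits.

Definition face_row (RR : realType) (m : nat) (i : 'I_m.+2)
    (t : 'rV[RR]_m.+1) : 'rV[RR]_m.+2 :=
  \row_j (if unlift i j is Some k then t 0 k else 0).

Lemma face_rowP (RR : realType) (m : nat) (i : 'I_m.+2) (t : std_simplex RR m) :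
  std_simplex RR m.+1 (face_row i (set_val t)).
Proof.
have [t_ge0 t_sum] := set_valP t; split=> [j|].
  by rewrite mxE; case: unliftP => [k _|_].
rewrite (bigD1 i)//= mxE unlift_none add0r -[RHS]t_sum.
rewrite (reindex_omap (lift i) (unlift i)) /=.
  apply: eq_big => [k|k _]; last by rewrite mxE liftK.
  by rewrite liftK eqxx andbT eq_sym neq_lift.
by move=> j; case: unliftP => [k ->//|-> /eqP].
Qed.

Definition face_fun (RR : realType) (m : nat) (i : 'I_m.+2)
    (t : std_simplex RR m) : std_simplex RR m.+1 :=
  exist _ (face_row i (set_val t)) (mem_set (face_rowP i t)).

Lemma face_fun_continuous (RR : realType) (m : nat) (i : 'I_m.+2) :
  continuous (@face_fun RR m i).
Proof.
apply/continuous_comp_initial => t /=.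
apply: (@continuous_comp _ _ _ set_val (@face_row RR m i)).
  exact: continuous_set_val.
move=> A [P nP sPA].
pose Q (_ : 'I_1) (k : 'I_m.+1) := P 0 (lift i k).
exists Q.
  move=> r k; rewrite ord1 /Q.
  by have := nP 0 (lift i k); rewrite mxE liftK.
move=> s Qs; apply: sPA => r j; rewrite ord1 mxE.
case: unliftP => [k ->|->]; first exact: Qs.
by have := nP 0 i; rewrite mxE unlift_none => /nbhs_singleton.
Qed.

Definition face (RR : realType) (m : nat) (i : 'I_m.+2) :
    continuousType (std_simplex RR m) (std_simplex RR m.+1) :=
  mkcts (@face_fun_continuous RR m i).

Definition singular_simplex (RR : realType) (X : topologicalType) (m : nat) :=
  continuousType (std_simplex RR m) X.

(** * Singular cohomology *)

Definition cochain (RR : realType) (X : topologicalType) (G : zmodType)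
  (m : nat) := singular_simplex RR X m -> G.

HB.instance Definition _ RR X G m :=
  GRing.Zmodule.on (@cochain RR X G m).

Section Cohomology.
Context {RR : realType} {X : topologicalType} {G : zmodType}.

Definition coboundary (m : nat) (c : cochain RR X G m) :
    cochain RR X G m.+1 :=
  fun s => \sum_(i < m.+2) c (s \o face RR i) *~ (-1) ^+ i.

Lemma coboundaryB (m : nat) : {morph @coboundary m : c d / c - d}.
Proof.
move=> c d; apply/funext => s.
rewrite -[RHS]/(coboundary c s - coboundary d s) /coboundary -sumrB.
by apply: eq_bigr => i _; rewrite -mulrzBl.
Qed.

Lemma coboundary0 (m : nat) : @coboundary m 0 = 0.
Proof. by have := coboundaryB (0 : cochain RR X G m) 0; rewrite !subrr. Qed.

Definition is_cocycle (m : nat) : {pred cochain RR X G m} :=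
  fun c => `[< coboundary c = 0 >].

Lemma is_cocycle_zmod_closed m : zmod_closed (@is_cocycle m).
Proof.
split; first by apply/asboolP; exact: coboundary0.
move=> c d /asboolP c0 /asboolP d0; apply/asboolP.
by rewrite coboundaryB c0 d0 subrr.
Qed.

HB.instance Definition _ m :=
  GRing.isZmodClosed.Build _ (@is_cocycle m) (is_cocycle_zmod_closed m).

Record cocycle (m : nat) := Cocycle {
  cocycle_val :> cochain RR X G m;
  cocycleP : cocycle_val \in @is_cocycle m }.

HB.instance Definition _ m := [isSub for @cocycle_val m].
HB.instance Definition _ m := [Choice of cocycle m by <:].
HB.instance Definition _ m := [SubChoice_isSubZmodule of cocycle m by <:].

Definition coboundary_prop (m : nat) : cochain RR X G m -> Prop :=
  match m with
  | 0 => fun c => c = 0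
  | m'.+1 => fun c => exists b : cochain RR X G m', c = coboundary b
  end.

Definition is_coboundary (m : nat) : {pred cocycle m} :=
  fun z => `[< coboundary_prop (z : cochain RR X G m) >].

Lemma is_coboundary_zmod_closed m : zmod_closed (@is_coboundary m).
Proof.
split.
  apply/asboolP; case: m => [//|m] /=.
  by exists 0; rewrite coboundary0.
move=> z z' /asboolP hz /asboolP hz'; apply/asboolP.
case: m z z' hz hz' => [|m] z z' /=.
  by move=> -> ->; rewrite subrr.
by move=> [b zb] [b' zb']; exists (b - b'); rewrite coboundaryB -zb -zb'.
Qed.

HB.instance Definition _ m :=
  GRing.isZmodClosed.Build _ (@is_coboundary m) (is_coboundary_zmod_closed m).

End Cohomology.

Arguments cocycle : clear implicits.

(* [H^m(X;G)] as the abelian group of cocycles modulo coboundaries. *)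
Definition cohomology (RR : realType) (X : topologicalType) (G : zmodType)
    (m : nat) : zmodType :=
  Quotient.quot (@is_coboundary RR X G m : zmodClosed (cocycle RR X G m)).

Definition cclass (RR : realType) (X : topologicalType) (G : zmodType)
    (m : nat) (z : cocycle RR X G m) : cohomology RR X G m :=
  \pi_(Quotient.quot (@is_coboundary RR X G m : zmodClosed _)) z.

Lemma cclassK (RR : realType) (X : topologicalType) (G : zmodType) (m : nat)
  (x : cohomology RR X G m) : cclass (repr x) = x.
Proof. exact: reprK. Qed.

Lemma cclassB (RR : realType) (X : topologicalType) (G : zmodType) (m : nat) :
  {morph @cclass RR X G m : z w / z - w}.
Proof. exact: raddfB. Qed.

Section Pullback.
Context {RR : realType} {X Y : topologicalType} {G : zmodType}.
Variable f : continuousType X Y.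

Definition pull_cochain (m : nat) (c : cochain RR Y G m) :
    cochain RR X G m :=
  fun s => c (f \o s).

Lemma pull_coboundary (m : nat) (c : cochain RR Y G m) :
  coboundary (pull_cochain c) = pull_cochain (coboundary c).
Proof.
apply/funext => s; apply: eq_bigr => i _; congr (c _ *~ _).
exact/continuousEP.
Qed.

Lemma pull_cocycleP (m : nat) (z : cocycle RR Y G m) :
  pull_cochain z \in @is_cocycle RR X G m.
Proof.
by apply/asboolP; rewrite pull_coboundary; have /asboolP -> := cocycleP z.
Qed.

Definition pull_cocycle (m : nat) (z : cocycle RR Y G m) :
  cocycle RR X G m := Cocycle (pull_cocycleP z).

(* The homomorphism [f^* : H^m(Y;G) -> H^m(X;G)], defined through the choice of
   a representing cocycle; [pullbackE] shows that the choice is immaterial. *)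
Definition pullback (m : nat) (x : cohomology RR Y G m) :
    cohomology RR X G m :=
  cclass (pull_cocycle (repr x)).

Lemma pullbackE (m : nat) (z : cocycle RR Y G m) :
  pullback (cclass z) = cclass (pull_cocycle z).
Proof.
apply/eqP; rewrite /pullback /cclass -Quotient.idealrBE.
have : repr (cclass z) - z \in @is_coboundary RR Y G m.
  by rewrite Quotient.idealrBE reprK.
move: (repr _) => z' /asboolP zz'; apply/asboolP.
case: m z z' zz' => [|m] z z' /=.
  move=> zz'; apply/funext => s.
  exact: (congr1 (fun c : cochain RR Y G 0 => c (f \o s)) zz').
move=> [b zz']; exists (pull_cochain b); rewrite pull_coboundary -zz'.
by apply/funext.
Qed.

Lemma pullbackB (m : nat) : {morph @pullback m : x y / x - y}.
Proof.
move=> x y; rewrite -[x]cclassK -[y]cclassK -cclassB !pullbackE -cclassB.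
by congr cclass; apply: val_inj.
Qed.

End Pullback.

(* [H^*(X;G)], the direct sum of the groups [H^m(X;G)]. *)
Record total_cohomology (RR : realType) (X : topologicalType) (G : zmodType) :=
  TotalCohomology {
    degree_part :> forall m, cohomology RR X G m;
    degree_part_finite :
      exists N, forall m, (N <= m)%N -> degree_part m = 0 }.

Section InDegree.
Context {RR : realType} {X : topologicalType} {G : zmodType}.
Variables (n : nat) (u : cohomology RR X G n).

Definition in_degree_part (m : nat) : cohomology RR X G m :=
  if @eqP _ n m is ReflectT e
  then eq_rect n (cohomology RR X G) u m e else 0.

Lemma in_degree_finite :
  exists N, forall m, (N <= m)%N -> in_degree_part m = 0.
Proof.
exists n.+1 => m nm; rewrite /in_degree_part; case: eqP => // e.
by have := nm; rewrite -[X in (_ < X)%N]e ltnn.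
Qed.

(* The inclusion of [H^n(X;G)] in [H^*(X;G)]. *)
Definition in_degree : total_cohomology RR X G :=
  TotalCohomology in_degree_finite.

Lemma in_degreeE : in_degree n = u.
Proof.
rewrite /= /in_degree_part; case: eqP => // e.
by rewrite (eq_irrelevance e erefl).
Qed.

Lemma in_degree_neq m : n != m -> in_degree m = 0.
Proof. by move=> nm; rewrite /= /in_degree_part; case: eqP nm. Qed.

End InDegree.

(* [J(f,g;G)], the image of [f^* - g^* : H^*(Y;G) -> H^*(X;G)]. *)
Definition J_image (RR : realType) (G : zmodType) (X Y : topologicalType)
    (f g : continuousType X Y) : set (total_cohomology RR X G) :=
  [set v | exists y : total_cohomology RR Y G,
     forall m, v m = pullback f (y m) - pullback g (y m)].

(** * Path-connected spaces and absolute neighborhood retracts *)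

Definition unit_interval (RR : realType) : set RR := `[0, 1].
Arguments unit_interval : clear implicits.

Lemma unit_interval0 (RR : realType) : unit_interval RR 0.
Proof. by rewrite /unit_interval /= in_itv /= lexx ler01. Qed.

Lemma unit_interval1 (RR : realType) : unit_interval RR 1.
Proof. by rewrite /unit_interval /= in_itv /= lexx ler01. Qed.

Definition I0 (RR : realType) : unit_interval RR :=
  exist _ 0 (mem_set (@unit_interval0 RR)).
Definition I1 (RR : realType) : unit_interval RR :=
  exist _ 1 (mem_set (@unit_interval1 RR)).

Definition path_connected (RR : realType) (X : topologicalType) : Prop :=
  forall x y : X, exists p : continuousType (unit_interval RR) X,
    p (I0 RR) = x /\ p (I1 RR) = y.

Definition metrizable (RR : realType) (X : topologicalType) : Prop :=
  exists (M : metricType RR) (h : continuousType X M) (k : continuousType M X),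
    cancel h k /\ cancel k h.

Definition closed_embedding (X Z : topologicalType) (j : X -> Z) : Prop :=
  [/\ continuous j, injective j & forall C, closed C -> closed (j @` C)].

(* Absolute neighborhood retract for the class of metrizable spaces: whenever X
   is a closed subspace of a metrizable Z, it is a retract of an open
   neighborhood U; the retraction is composed with the inverse of X -> j(X). *)
Definition ANR (RR : realType) (X : topologicalType) : Prop :=
  metrizable RR X /\
  forall (Z : topologicalType) (j : X -> Z),
    metrizable RR Z -> closed_embedding j ->
    exists U : set Z, [/\ open U, range j `<=` U &
      exists r : continuousType U X,
        forall (z : U) (x : X), set_val z = j x -> r z = x].

(** * Cohomological distance *)

Definition cohom_cover (RR : realType) (G : zmodType) (A Y : topologicalType)
    (p q : continuousType A Y) (n : nat) : Prop :=
  exists U : 'I_n.+1 -> set A,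
    [/\ forall j, open (U j), \bigcup_j U j = [set: A] &
        forall j m (y : cohomology RR Y G m),
          pullback (p \o subspace_incl (U j)) y =
          pullback (q \o subspace_incl (U j)) y].

(* The set below has at most one element, which [xget] returns if it exists. *)
Definition cohom_distance (RR : realType) (G : zmodType) (A Y : topologicalType)
    (p q : continuousType A Y) : \bar int :=
  xget +oo%E [set (n%:Z)%:E | n in [set n : nat |
    cohom_cover RR G p q n /\
    forall m, cohom_cover RR G p q m -> (n <= m)%N]].

(** * Cohomological weight *)

(* [k] is an integer: every [k < 0] satisfies this, the distance being
   nonnegative, so that a class not killed by any [k >= 0] has weight 0. *)
Definition weight_bound (RR : realType) (R S : zmodType)
    (X Y : topologicalType) (f g : continuousType X Y)
    (v : total_cohomology RR X S) (k : int) : Prop :=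
  forall (A : topologicalType) (phi : continuousType A X),
    path_connected RR A ->
    (cohom_distance RR R (f \o phi) (g \o phi) <= k%:E)%E ->
    forall m, pullback phi (v m) = 0.

Definition cohom_weight (RR : realType) (R S : zmodType)
    (X Y : topologicalType) (f g : continuousType X Y)
    (v : total_cohomology RR X S) : \bar int :=
  if `[< forall m, v m = 0 >] then +oo%E
  else xget +oo%E [set (k + 1)%:E | k in [set k : int |
    weight_bound R f g v k /\
    forall k', weight_bound R f g v k' -> k' <= k]].

(** * The suspension isomorphism *)

Section Collapse.
Variables (X : topologicalType) (A : set X).

Definition collapse_eq (x y : X) : bool := `[< x = y \/ A x /\ A y >].

Lemma collapse_eq_refl : reflexive collapse_eq.
Proof. by move=> x; apply/asboolP; left. Qed.

Lemma collapse_eq_sym : symmetric collapse_eq.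
Proof.
by move=> x y; apply/asboolP/asboolP => -[->|[? ?]]; by [left|right].
Qed.

Lemma collapse_eq_trans : transitive collapse_eq.
Proof.
move=> y x z /asboolP[->//|[Ax Ay]] /asboolP[<-|[_ Az]]; apply/asboolP;
by right.
Qed.

Definition collapse_rel :=
  EquivRel _ collapse_eq_refl collapse_eq_sym collapse_eq_trans.

(* The quotient space [X/A] (equal to [X] when [A] is empty). *)
Definition collapse := {eq_quot collapse_rel}.

HB.instance Definition _ :=
  Topological.copy collapse (quotient_topology collapse).
HB.instance Definition _ := Quotient.on collapse.

Definition collapse_fun (x : X) : collapse := \pi_collapse x.

Lemma collapse_fun_continuous : continuous collapse_fun.
Proof. exact: (@pi_continuous X collapse). Qed.

Definition collapse_map : continuousType X collapse :=
  mkcts collapse_fun_continuous.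

End Collapse.

Definition cone (RR : realType) (Z : topologicalType) : topologicalType :=
  collapse [set p : Z * unit_interval RR | p.2 = I0 RR].

Lemma cone_base_continuous (RR : realType) (Z : topologicalType) :
  continuous (fun z : Z => (z, I1 RR)).
Proof. move=> z A [[U V] /= [Uz V1] UVA]; apply: filterS Uz => y Uy.
by apply: UVA; split=> //=; exact: nbhs_singleton V1. Qed.

Definition cone_base (RR : realType) (Z : topologicalType) :
    continuousType Z (cone RR Z) :=
  collapse_map [set p : Z * unit_interval RR | p.2 = I0 RR] \o
    mkcts (@cone_base_continuous RR Z).

Definition suspension (RR : realType) (Z : topologicalType) : topologicalType :=
  collapse (range (cone_base RR Z)).

Definition cone_to_suspension (RR : realType) (Z : topologicalType) :
    continuousType (cone RR Z) (suspension RR Z) :=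
  collapse_map (range (cone_base RR Z)).

Definition suspension_pt (RR : realType) (Z : topologicalType) (z0 : Z) :
    suspension RR Z :=
  cone_to_suspension RR Z (cone_base RR Z z0).

(* [a] lies in the reduced cohomology of the pointed space [(Z,z0)], that is in
   the kernel of the restriction to the base point. *)
Definition reduced (RR : realType) (Z : topologicalType) (G : zmodType)
    (z0 : Z) (m : nat) (a : cohomology RR Z G m) : Prop :=
  pullback (subspace_incl [set z0]) a = 0.

(* For reduced [a], this says that [b] is the image of [a] under the suspension
   isomorphism, i.e. under the composite of the connecting homomorphism of the
   pair [(CZ,Z)] with the isomorphism induced by [CZ -> CZ/Z = SZ]:
     H^m(Z) -> H^m+1(CZ,Z) <- H^m+1(SZ,pt) -> H^m+1(SZ).
   At the level of cochains, a cocycle [alpha] of class [a] on the base is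
   extended to a cochain [gamma] on the cone, whose coboundary is the pullback
   of a cocycle [beta] of class [b] that vanishes on the base point. *)
Definition suspends_to (RR : realType) (Z : topologicalType) (G : zmodType)
    (z0 : Z) (m : nat) (a : cohomology RR Z G m)
    (b : cohomology RR (suspension RR Z) G m.+1) : Prop :=
  exists (alpha : cocycle RR Z G m)
         (gamma : cochain RR (cone RR Z) G m)
         (beta : cocycle RR (suspension RR Z) G m.+1),
    [/\ cclass alpha = a, cclass beta = b,
        pull_cochain (subspace_incl [set suspension_pt RR z0]) beta = 0,
        pull_cochain (cone_base RR Z) gamma = alpha &
        coboundary gamma = pull_cochain (cone_to_suspension RR Z) beta].

(** * Stable cohomology operations *)

(* The degree [i] is an arbitrary integer; [H^k = 0] for [k < 0], so a component
   [H^m -> H^(m+i)] carries data only when [m + i] is a natural number [k]. *)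
Record cohomology_operation (RR : realType) (G G' : zmodType) (i : int) :=
  CohomologyOperation {
    operation :> forall (Z : topologicalType) (m k : nat), m%:Z + i = k%:Z ->
      cohomology RR Z G m -> cohomology RR Z G' k;
    operation_natural : forall (Z W : topologicalType) (h : continuousType Z W)
      (m k : nat) (e : m%:Z + i = k%:Z) (x : cohomology RR W G m),
      operation e (pullback h x) = pullback h (operation e x) }.

(* The suspension isomorphism relates the reduced groups, so it is required
   that [theta] maps reduced classes to reduced classes (equivalently, that it
   preserves 0) and then that it commutes with the isomorphism. In the case
   [m + i = -1] commutation means that [theta] vanishes on suspended classes,
   which follows from the first clause as suspensions are path-connected. *)
Definition stable (RR : realType) (G G' : zmodType) (i : int)
    (theta : cohomology_operation RR G G' i) : Prop :=
  (forall (Z : topologicalType) (z0 : Z) (m k : nat) (e : m%:Z + i = k%:Z)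
     (a : cohomology RR Z G m),
     reduced z0 a -> reduced z0 (theta Z m k e a)) /\
  (forall (Z : topologicalType) (z0 : Z) (m k : nat) (e : m%:Z + i = k%:Z)
     (e' : m.+1%:Z + i = k.+1%:Z) (a : cohomology RR Z G m)
     (b : cohomology RR (suspension RR Z) G m.+1),
     reduced z0 a -> suspends_to z0 a b ->
     suspends_to z0 (theta Z m k e a)
       (theta (suspension RR Z) m.+1 k.+1 e' b)).

Definition vanishes_below (RR : realType) (G G' : zmodType) (i : int)
    (theta : cohomology_operation RR G G' i) (n : nat) : Prop :=
  forall (Z : topologicalType) (m k : nat) (e : m%:Z + i = k%:Z)
    (u : cohomology RR Z G m), (m < n)%N -> theta Z m k e u = 0.

(* Set to 0 when there is no [n > 0] as in the definition of the excess. *)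
Definition excess (RR : realType) (G G' : zmodType) (i : int)
    (theta : cohomology_operation RR G G' i) : \bar int :=
  if `[< forall n, vanishes_below theta n >] then +oo%E
  else xget 0%E [set (n%:Z)%:E | n in [set n : nat |
    [/\ (0 < n)%N, vanishes_below theta n &
        forall n', vanishes_below theta n' -> (n' <= n)%N]]].

(* Main.v *)
(* Since [phi^* u = (f phi)^* y - (g phi)^* y], the class [w = phi^* u] vanishes
   on the two members of an open cover {U, V} of A. By Mayer-Vietoris [w] comes
   from a class [c] of degree n - 1 on the intersection W, and theta kills [c]
   because its excess is at least n. That theta commutes with the Mayer-Vietoris
   connecting homomorphism is seen geometrically: on the double mapping cylinder
   M of U <- W -> V, the pullback of [w] is also the pullback of the suspension
   of [c] along a map from M to the suspension of W. As theta commutes with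
   suspension, theta(w) vanishes on M, and M -> A is injective in cohomology.
   Each of these steps is a Mayer-Vietoris gluing, which rests on the acyclicity
   of the cochains vanishing on the simplices of U and of V; the subdivision
   operators and prisms are constructed directly on cochains, by duality from
   the usual cone recursions. *)

Require Import Defs.
From mathcomp Require Import all_boot all_order all_algebra.
From mathcomp Require Import generic_quotient ring_quotient lra.
From mathcomp Require Import all_classical all_reals.
From mathcomp Require Import topology normedtype sequences.

Set Implicit Arguments.
Unset Strict Implicit.
Unset Printing Implicit Defensive.

Import Order.TTheory GRing.Theory Num.Theory numFieldNormedType.Exports.
Local Open Scope classical_set_scope.
Local Open Scope ring_scope.

(** A partition of unity subordinate to {U, V} would give a map from A to the suspension of W
    directly. Since A is an arbitrary space, M supplies the height coordinate instead.
    [cohomology_operation] does not include additivity, so theta is applied to single classes and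
    moved only by naturality and stability; sums and differences are formed on cochains. Stability
    relates theta in degree n to theta in degree n - 1 only when the target degree of the latter is
    a natural number; target degree 0 is therefore settled pointwise. It also needs a base point in
    W: as A is path-connected, W is nonempty unless U or V is all of A. Finally c must be reduced,
    which is arranged by changing the primitive of w on U by a cocycle. Each singular simplex turns
    a singular cochain into a function on tuples of points of its domain, where the cone formulas
    are combinatorial. *)

Lemma subrACA (V : zmodType) (x y z t : V) :
  (x - y) - (z - t) = (x - z) - (y - t).
Proof. by rewrite !opprD addrACA. Qed.

Lemma subrBB (V : zmodType) (x y z : V) : (x - z) - (y - z) = x - y.
Proof. by rewrite subrACA subrr subr0. Qed.

(** * Cochains on ordered tuples *)

Section OrderedCochains.
Context {G : zmodType}.

(** In use [K] consists of points of a convex set and a tuple stands for the affine simplex it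
    spans. Repeated entries are allowed, so every cone is available. *)
Definition ordered_cochain (K : Type) (l : nat) := ('I_l.+1 -> K) -> G.

Definition ocoboundary (K : Type) l (c : ordered_cochain K l) :
    ordered_cochain K l.+1 :=
  fun v => \sum_(i < l.+2) c (v \o lift i) *~ (-1) ^+ i.

Definition vcons (K : Type) l (b : K) (v : 'I_l.+1 -> K) : 'I_l.+2 -> K :=
  fun i => if unlift ord0 i is Some j then v j else b.

Definition cone_cochain (K : Type) l (b : K) (c : ordered_cochain K l.+1) :
    ordered_cochain K l :=
  fun v => c (vcons b v).

Lemma vcons_lift0 (K : Type) l (b : K) (v : 'I_l.+1 -> K) :
  vcons b v \o lift ord0 = v.
Proof. by apply/funext => i; rewrite /vcons /= liftK. Qed.

Lemma vcons_lift (K : Type) l (b : K) (v : 'I_l.+2 -> K) (i : 'I_l.+2) :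
  vcons b v \o lift (lift ord0 i) = vcons b (v \o lift i).
Proof.
apply/funext => j; rewrite /vcons /=.
case: (unliftP ord0 j) => [k ->|->] /=; last first.
  have -> : lift (lift ord0 i) ord0 = ord0 by apply/val_inj.
  by rewrite unlift_none.
have -> : lift (lift ord0 i) (lift ord0 k) = lift ord0 (lift i k).
  by apply/val_inj; rewrite /= /bump !leq0n !add1n ltnS addnS.
by rewrite liftK.
Qed.

Lemma vcons_lift_pt (K : Type) (b : K) (v : 'I_1 -> K) (i : 'I_1) :
  vcons b v \o lift (lift ord0 i) = fun=> b.
Proof.
apply/funext => j; rewrite /vcons /= !ord1.
rewrite (_ : lift _ _ = ord0); first by rewrite unlift_none.
exact/val_inj.
Qed.

Lemma vcons_eta (K : Type) l (v : 'I_l.+2 -> K) :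
  v = vcons (v ord0) (v \o lift ord0).
Proof.
apply/funext => i; rewrite /vcons.
by case: (unliftP ord0 i) => [k ->|->].
Qed.

Lemma ocoboundaryB (K : Type) l : {morph @ocoboundary K l : c d / c - d}.
Proof.
move=> c d; apply/funext => v.
rewrite -[RHS]/(ocoboundary c v - ocoboundary d v) /ocoboundary -sumrB.
by apply: eq_bigr => i _; rewrite -mulrzBl.
Qed.

(** Dual to the boundary of a cone: the face opposite [b] is [v], the other faces are cones over the
    faces of [v], with the sign shifted. *)
Lemma cone_ocoboundary (K : Type) l (b : K) (c : ordered_cochain K l.+1) :
  cone_cochain b (ocoboundary c) = c - ocoboundary (cone_cochain b c).
Proof.
apply/funext => v; rewrite -[RHS]/(c v - ocoboundary (cone_cochain b c) v).
rewrite /cone_cochain /ocoboundary big_ord_recl /= vcons_lift0 expr0 mulr1z.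
congr (_ + _); rewrite -sumrN; apply: eq_bigr => i _.
by rewrite vcons_lift /bump leq0n add1n exprS mulN1r mulrNz.
Qed.

(** One face of the cone over a point is the apex alone, so a constant replaces the coboundary term;
    hence the separate treatment of degree 0 below. *)
Lemma cone_ocoboundary_pt (K : Type) (b : K) (c : ordered_cochain K 0) :
  cone_cochain b (ocoboundary c) = c - (fun=> c (fun=> b)).
Proof.
apply/funext => v; rewrite -[RHS]/(c v - c (fun=> b)).
rewrite /cone_cochain /ocoboundary big_ord_recl /= vcons_lift0 expr0 mulr1z.
by rewrite big_ord1 vcons_lift_pt expr1 mulrN1z.
Qed.

Lemma ocoboundary_cst (K : Type) (a : G) :
  ocoboundary ((fun=> a) : ordered_cochain K 0) = 0.
Proof.
apply/funext => v; rewrite /ocoboundary big_ord_recl big_ord1 /=.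
by rewrite expr0 expr1 mulr1z mulrN1z subrr.
Qed.

(* A (l+2)-simplex is the cone from its first vertex over its first face. *)
Lemma ocoboundaryK (K : Type) l (c : ordered_cochain K l) :
  ocoboundary (ocoboundary c) = 0.
Proof.
elim: l c => [|l IHl] c; apply/funext => v; rewrite (vcons_eta v);
  rewrite -/(cone_cochain _ _ _) cone_ocoboundary.
  by rewrite cone_ocoboundary_pt ocoboundaryB ocoboundary_cst subr0 subrr.
by rewrite cone_ocoboundary ocoboundaryB IHl subr0 subrr.
Qed.

Lemma ocochainBE (K : Type) l (c d : ordered_cochain K l) v :
  (c - d) v = c v - d v.
Proof. by []. Qed.

Lemma cone_cochainB (K : Type) l (b : K) :
  {morph @cone_cochain K l b : c d / c - d}.
Proof. by []. Qed.

Section Homotopy.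
Variables (K L : Type).
Variables (F F' : forall l, ordered_cochain L l -> ordered_cochain K l).
Variable b : forall l, ('I_l.+1 -> K) -> L.

(* Dual to the recursion [T v = b v * (F v - F' v - T (boundary v))], with [*]
   denoting the cone. *)
Fixpoint cone_homotopy l : ordered_cochain L l.+1 -> ordered_cochain K l :=
  match l with
  | 0 => fun c v =>
      let d := cone_cochain (b v) c in F d v - F' d v
  | l'.+1 => fun c v =>
      let d := cone_cochain (b v) c in
      F d v - F' d v - ocoboundary (cone_homotopy d) v
  end.

Lemma cone_homotopySE l (c : ordered_cochain L l.+2) v :
  cone_homotopy c v = F (cone_cochain (b v) c) v - F' (cone_cochain (b v) c) v -
    ocoboundary (cone_homotopy (cone_cochain (b v) c)) v.
Proof. by []. Qed.

Hypothesis FB : forall l, {morph @F l : c d / c - d}.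
Hypothesis F'B : forall l, {morph @F' l : c d / c - d}.
Hypothesis Fd : forall l (c : ordered_cochain L l),
  F (ocoboundary c) = ocoboundary (F c).
Hypothesis F'd : forall l (c : ordered_cochain L l),
  F' (ocoboundary c) = ocoboundary (F' c).
(** Plays the part of compatibility with augmentations: it cancels the constants from
    [cone_ocoboundary_pt]. *)
Hypothesis F_cst : forall a : G,
  F ((fun=> a) : ordered_cochain L 0) = F' ((fun=> a) : ordered_cochain L 0).

Lemma cone_homotopyB l : {morph @cone_homotopy l : c d / c - d}.
Proof.
elim: l => [|l IHl] c d; apply/funext => v; rewrite ocochainBE /=.
  by rewrite cone_cochainB FB F'B !ocochainBE; apply: subrACA.
rewrite cone_cochainB FB F'B IHl ocoboundaryB !ocochainBE.
by rewrite -[RHS]subrACA; congr (_ - _); apply: subrACA.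
Qed.

Lemma cone_homotopy_pt (c : ordered_cochain L 0) :
  cone_homotopy (ocoboundary c) = F c - F' c.
Proof.
apply/funext => v /=; rewrite cone_ocoboundary_pt FB F'B F_cst !ocochainBE.
by rewrite subrACA subrr subr0.
Qed.

(** Let [d] be [c] coned off at [b v]. One step of the recursion yields the wanted terms plus the
    coboundaries of [F' d - F d] and of the homotopy on [ocoboundary d]; by induction these two
    cancel. *)
Lemma cone_homotopyP l (c : ordered_cochain L l.+1) :
  cone_homotopy (ocoboundary c) = F c - F' c - ocoboundary (cone_homotopy c).
Proof.
elim: l c => [|l IHl] c; apply/funext => v;
  rewrite ocochainBE cone_homotopySE cone_ocoboundary FB F'B Fd F'd
    cone_homotopyB ocoboundaryB.
  rewrite cone_homotopy_pt ocoboundaryB !ocochainBE.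
  by rewrite (subrACA (F c v)) subrBB.
rewrite IHl !ocoboundaryB ocoboundaryK subr0 !ocochainBE.
by rewrite (subrACA (F c v)) subrBB.
Qed.

End Homotopy.

Section Subdivision.
Variables (K : Type) (bary : forall l, ('I_l.+1 -> K) -> K).

(** Dual to [sd v = bary v * sd (boundary v)], with [*] denoting the cone. *)
Fixpoint subdivide l : ordered_cochain K l -> ordered_cochain K l :=
  match l with
  | 0 => id
  | l'.+1 => fun c v => ocoboundary (subdivide (cone_cochain (bary v) c)) v
  end.

Lemma subdivideSE l (c : ordered_cochain K l.+1) v :
  subdivide c v = ocoboundary (subdivide (cone_cochain (bary v) c)) v.
Proof. by []. Qed.

Lemma subdivideB l : {morph @subdivide l : c d / c - d}.
Proof.
elim: l => [|l IHl] c d //; apply/funext => v /=.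
by rewrite cone_cochainB IHl ocoboundaryB.
Qed.

Lemma subdivide_ocoboundary l (c : ordered_cochain K l) :
  subdivide (ocoboundary c) = ocoboundary (subdivide c).
Proof.
elim: l c => [|l IHl] c; apply/funext => v;
  rewrite subdivideSE.
  by rewrite cone_ocoboundary_pt ocoboundaryB ocoboundary_cst subr0.
rewrite cone_ocoboundary subdivideB IHl !ocoboundaryB.
by rewrite ocoboundaryK subr0.
Qed.

Definition subdivision_homotopy l :
    ordered_cochain K l.+1 -> ordered_cochain K l :=
  cone_homotopy (fun _ c => c) subdivide bary (l := l).

Lemma subdivision_homotopyB l : {morph @subdivision_homotopy l : c d / c - d}.
Proof. by apply: cone_homotopyB => // k; exact: subdivideB. Qed.

Lemma subdivision_homotopyP l (c : ordered_cochain K l.+1) :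
  subdivision_homotopy (ocoboundary c) =
  c - subdivide c - ocoboundary (subdivision_homotopy c).
Proof.
apply: cone_homotopyP => // k; first exact: subdivideB.
exact: subdivide_ocoboundary.
Qed.

End Subdivision.

Definition opull (K K' : Type) (a : K -> K') l (c : ordered_cochain K' l) :
  ordered_cochain K l := fun v => c (a \o v).

Lemma ocoboundary_opull (K K' : Type) (a : K -> K') l
  (c : ordered_cochain K' l) :
  ocoboundary (opull a c) = opull a (ocoboundary c).
Proof. by []. Qed.

Lemma opull_vcons (K K' : Type) (a : K -> K') l (x : K) (v : 'I_l.+1 -> K) :
  a \o vcons x v = vcons (a x) (a \o v).
Proof.
by apply/funext => i; rewrite /vcons /=; case: (unliftP ord0 i).
Qed.

Lemma cone_opull (K K' : Type) (a : K -> K') l x (c : ordered_cochain K' l.+1) :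
  cone_cochain x (opull a c) = opull a (cone_cochain (a x) c).
Proof. by apply/funext => v; rewrite /opull /cone_cochain opull_vcons. Qed.

(** Naturality under maps that preserve the apexes. Affine maps preserve barycenters, so an operator
    defined at the vertices of a simplex is determined on every affine simplex inside it. *)
Lemma subdivide_opull (K K' : Type) (a : K -> K')
    (bary : forall l, ('I_l.+1 -> K) -> K)
    (bary' : forall l, ('I_l.+1 -> K') -> K') l (c : ordered_cochain K' l) :
  (forall k (v : 'I_k.+1 -> K), a (bary k v) = bary' k (a \o v)) ->
  subdivide bary (opull a c) = opull a (subdivide bary' c).
Proof.
move=> baryE; elim: l c => [|l IHl] c //; apply/funext => v /=.
by rewrite cone_opull IHl ocoboundary_opull baryE.
Qed.

Lemma cone_homotopy_opull (K K' L L' : Type) (a : K -> K') (a' : L -> L')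
    (F F' : forall l, ordered_cochain L l -> ordered_cochain K l)
    (F1 F1' : forall l, ordered_cochain L' l -> ordered_cochain K' l)
    (b : forall l, ('I_l.+1 -> K) -> L) (b' : forall l, ('I_l.+1 -> K') -> L')
    l (c : ordered_cochain L' l.+1) :
  (forall k (d : ordered_cochain L' k), F k (opull a' d) = opull a (F1 k d)) ->
  (forall k (d : ordered_cochain L' k),
     F' k (opull a' d) = opull a (F1' k d)) ->
  (forall k (v : 'I_k.+1 -> K), a' (b k v) = b' k (a \o v)) ->
  cone_homotopy F F' b (opull a' c) = opull a (cone_homotopy F1 F1' b' c).
Proof.
move=> FE F'E bE; elim: l c => [|l IHl] c; apply/funext => v /=;
  rewrite cone_opull FE F'E bE //.
by rewrite IHl ocoboundary_opull.
Qed.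

End OrderedCochains.

(** * Subdivision of singular cochains *)

Section AffineSimplices.
Context {RR : realType}.
Local Notation Delta := (std_simplex RR).

Lemma simplex_ge0 m (t : Delta m) j : 0 <= set_val t 0 j.
Proof. by have [] := set_valP t. Qed.

Lemma simplex_sum1 m (t : Delta m) : \sum_j set_val t 0 j = 1.
Proof. by have [] := set_valP t. Qed.

Lemma simplex_eqP m (s t : Delta m) :
  (forall j, set_val s 0 j = set_val t 0 j) -> s = t.
Proof. by move=> st; apply/val_inj/rowP. Qed.

Lemma simplex_coord_continuous m j :
  continuous (fun t : Delta m => set_val t 0 j).
Proof.
move=> t; apply: (@continuous_comp (Delta m) 'rV[RR]_m.+1 RR set_val
  (fun x => x 0 j)); last exact: coord_continuous.
exact: continuous_set_val.
Qed.

Definition affine_row l m (v : 'I_l.+1 -> Delta m) (t : Delta l) :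
  'rV[RR]_m.+1 := \sum_j set_val t 0 j *: set_val (v j).

Lemma affine_rowE l m (v : 'I_l.+1 -> Delta m) (t : Delta l) k :
  affine_row v t 0 k = \sum_j set_val t 0 j * set_val (v j) 0 k.
Proof. by rewrite summxE; apply: eq_bigr => j _; rewrite mxE. Qed.

Lemma affine_rowP l m (v : 'I_l.+1 -> Delta m) (t : Delta l) :
  Delta m (affine_row v t).
Proof.
split=> [k|].
  by rewrite affine_rowE sumr_ge0// => j _; rewrite mulr_ge0 ?simplex_ge0.
rewrite -[RHS](simplex_sum1 t); under eq_bigr do rewrite affine_rowE.
rewrite exchange_big; apply: eq_bigr => j _ /=.
by rewrite -mulr_sumr simplex_sum1 mulr1.
Qed.

Definition affine_fun l m (v : 'I_l.+1 -> Delta m) (t : Delta l) : Delta m :=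
  exist _ (affine_row v t) (mem_set (affine_rowP v t)).

Lemma affine_fun_continuous l m (v : 'I_l.+1 -> Delta m) :
  continuous (affine_fun v).
Proof.
apply/continuous_comp_initial; rewrite -[_ \o _]/(affine_row v).
apply: continuous_big => [|j _ t]; first exact: add_continuous.
exact: (cvgZr_tmp (@simplex_coord_continuous l j t)).
Qed.

Definition affine l m (v : 'I_l.+1 -> Delta m) :
  continuousType (Delta l) (Delta m) := mkcts (@affine_fun_continuous l m v).

Lemma affineE l m (v : 'I_l.+1 -> Delta m) t k :
  set_val (affine v t) 0 k = \sum_j set_val t 0 j * set_val (v j) 0 k.
Proof. exact: affine_rowE. Qed.

Lemma affine_face l m (v : 'I_l.+2 -> Delta m) (i : 'I_l.+2) t :
  affine v (face RR i t) = affine (v \o lift i) t.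
Proof.
apply: simplex_eqP => k.
rewrite !affineE (bigD1 i)//= mxE unlift_none mul0r add0r.
rewrite (reindex_omap (lift i) (unlift i)) /=; last first.
  by move=> j; case: unliftP => [h ->//|-> /eqP].
apply: eq_big => [h|h _]; last by rewrite mxE liftK.
by rewrite liftK eqxx andbT eq_sym neq_lift.
Qed.

Lemma affine_affine k l m (w : 'I_l.+1 -> Delta m) (v : 'I_k.+1 -> Delta l) t :
  affine w (affine v t) = affine (affine w \o v) t.
Proof.
apply: simplex_eqP => h; rewrite !affineE.
under eq_bigr do rewrite affineE mulr_suml.
rewrite exchange_big; apply: eq_bigr => j _ /=.
rewrite affineE mulr_sumr; apply: eq_bigr => i _.
by rewrite mulrA.
Qed.

Lemma vertex_subproof m (j : 'I_m.+1) : Delta m (delta_mx 0 j).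
Proof.
split=> [k|]; first by rewrite mxE ler0n.
rewrite (bigD1 j)//= mxE !eqxx big1 ?addr0// => k kj.
by rewrite mxE eqxx/= (negbTE kj).
Qed.

Definition vertex m (j : 'I_m.+1) : Delta m :=
  exist _ (delta_mx 0 j) (mem_set (vertex_subproof j)).

Lemma affine_vertex l m (v : 'I_l.+1 -> Delta m) j : affine v (vertex j) = v j.
Proof.
apply: simplex_eqP => k; rewrite affineE (bigD1 j)//= mxE !eqxx mul1r.
rewrite big1 ?addr0// => i ij; by rewrite mxE eqxx/= (negbTE ij) mul0r.
Qed.

Lemma affine_vertices m t : affine (@vertex m) t = t.
Proof.
apply: simplex_eqP => k; rewrite affineE (bigD1 k)//= mxE !eqxx mulr1.
rewrite big1 ?addr0// => i ij; by rewrite mxE eqxx/= eq_sym (negbTE ij) mulr0.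
Qed.

Lemma affine_face_vertex m (i : 'I_m.+2) t :
  face RR i t = affine (@vertex m.+1 \o lift i) t.
Proof. by rewrite -affine_face affine_vertices. Qed.

Lemma barycenter_subproof l : Delta l (const_mx l.+1%:R^-1).
Proof.
split=> [k|]; first by rewrite mxE invr_ge0 ler0n.
under eq_bigr do rewrite mxE.
by rewrite sumr_const card_ord -[LHS]mulr_natr mulVf // pnatr_eq0.
Qed.

Definition simplex_center l : Delta l :=
  exist _ (const_mx l.+1%:R^-1) (mem_set (barycenter_subproof l)).

Definition barycenter m l (v : 'I_l.+1 -> Delta m) : Delta m :=
  affine v (simplex_center l).

Lemma affine_barycenter k l m (w : 'I_l.+1 -> Delta m)
    (v : 'I_k.+1 -> Delta l) :
  affine w (barycenter v) = barycenter (affine w \o v).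
Proof. exact: affine_affine. Qed.

End AffineSimplices.

Section SingularOperators.
Context {RR : realType} {G : zmodType}.
Local Notation Delta := (std_simplex RR).

Section Sharp.
Context {X : topologicalType}.

(** Commutes with coboundaries and gives back [c s] at the vertices; this is how singular identities
    reduce to identities on tuples. *)
Definition sharp m (s : singular_simplex RR X m) l (c : cochain RR X G l) :
  @ordered_cochain G (Delta m) l := fun v => c (s \o affine v).

Lemma sharp_coboundary m (s : singular_simplex RR X m) l
    (c : cochain RR X G l) :
  sharp s (coboundary c) = ocoboundary (sharp s c).
Proof.
apply/funext => v; apply: eq_bigr => i _; congr (c _ *~ _).
by apply/continuousEP => t /=; rewrite affine_face.
Qed.

Lemma sharp_vertices l (s : singular_simplex RR X l) (c : cochain RR X G l) :
  sharp s c (@vertex RR l) = c s.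
Proof. by congr c; apply/continuousEP => t /=; rewrite affine_vertices. Qed.

Lemma sharp_affine m k (s : singular_simplex RR X m) (w : 'I_k.+1 -> Delta m)
    l (c : cochain RR X G l) :
  sharp (s \o affine w) c = opull (affine w) (sharp s c).
Proof.
apply/funext => v; congr c; apply/continuousEP => t /=.
by rewrite affine_affine.
Qed.

Lemma face_affineE m (s : singular_simplex RR X m.+1) (i : 'I_m.+2) :
  s \o face RR i = s \o affine (@vertex RR m.+1 \o lift i)
    :> singular_simplex RR X m.
Proof. by apply/continuousEP => t /=; rewrite -affine_face_vertex. Qed.

Lemma coboundaryK l (c : cochain RR X G l) : coboundary (coboundary c) = 0.
Proof.
apply/funext => s; rewrite -sharp_vertices !sharp_coboundary.
by rewrite ocoboundaryK.
Qed.

Definition sd l (c : cochain RR X G l) : cochain RR X G l :=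
  fun s => subdivide (@barycenter RR l) (sharp s c) (@vertex RR l).

Lemma sharp_sd m (s : singular_simplex RR X m) l (c : cochain RR X G l) :
  sharp s (sd c) = subdivide (@barycenter RR m) (sharp s c).
Proof.
apply/funext => v; rewrite /sharp /sd -/(sharp _ _) sharp_affine.
rewrite (@subdivide_opull _ _ _ _ _ (@barycenter RR m)); last first.
  by move=> k w; exact: affine_barycenter.
by congr subdivide; apply/funext => j /=; rewrite affine_vertex.
Qed.

Lemma sd_coboundary l (c : cochain RR X G l) :
  sd (coboundary c) = coboundary (sd c).
Proof.
apply/funext => s; rewrite -!sharp_vertices sharp_sd !sharp_coboundary.
by rewrite sharp_sd subdivide_ocoboundary.
Qed.

Definition sd_homotopy l (c : cochain RR X G l.+1) : cochain RR X G l :=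
  fun s => subdivision_homotopy (@barycenter RR l) (sharp s c) (@vertex RR l).

Lemma sharp_sd_homotopy m (s : singular_simplex RR X m) l
    (c : cochain RR X G l.+1) :
  sharp s (sd_homotopy c) = subdivision_homotopy (@barycenter RR m) (sharp s c).
Proof.
apply/funext => v; rewrite /sharp /sd_homotopy -/(sharp _ _) sharp_affine.
rewrite /subdivision_homotopy.
rewrite (@cone_homotopy_opull _ _ _ _ _ (affine v) (affine v) _ _ (fun _ c => c)
  (subdivide (@barycenter RR m)) _ (@barycenter RR m))//.
- by congr cone_homotopy; apply/funext => j /=; rewrite affine_vertex.
- by move=> k d; apply: subdivide_opull => h w; exact: affine_barycenter.
- by move=> k w; exact: affine_barycenter.
Qed.

Lemma coboundary_sd_homotopy l (c : cochain RR X G l.+1) :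
  coboundary (sd_homotopy c) = c - sd c - sd_homotopy (coboundary c).
Proof.
apply/funext => s; rewrite -[LHS]sharp_vertices sharp_coboundary.
rewrite sharp_sd_homotopy.
rewrite -[RHS]/(c s - sd c s - sd_homotopy (coboundary c) s).
rewrite /sd_homotopy sharp_coboundary subdivision_homotopyP !ocochainBE.
by rewrite sharp_vertices -/(sd c s) opprB [RHS]addrC subrK.
Qed.

End Sharp.
End SingularOperators.

(** * Mesh estimates and the Lebesgue number *)

Lemma open_preimage_val (T X : topologicalType) (K : set T)
    (f : continuousType K X) (O : set X) :
  open O ->
  exists2 P : set T, open P & forall t : K, P (set_val t) <-> O (f t).
Proof.
move=> oO; have [P oP PE] : open (f @^-1` O).
  by apply: open_comp => // t _; exact: cts_fun.
by exists P => // t; have := congr1 (@^~ t) PE; rewrite /preimage /= => ->.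
Qed.

Section Mesh.
Context {RR : realType}.
Local Notation Delta := (std_simplex RR).

Definition mesh_le l m (v : 'I_l.+1 -> Delta m) (d : RR) : Prop :=
  forall i j, `|set_val (v i) - set_val (v j)| <= d.

(* Stands in for the convex hull of [v] in the mesh estimates. *)
Definition ball_hull l m (v : 'I_l.+1 -> Delta m) (x : Delta m) : Prop :=
  forall (c : 'rV[RR]_m.+1) (r : RR),
    (forall i, `|c - set_val (v i)| <= r) -> `|c - set_val x| <= r.

Lemma sub_affine_row l m (v : 'I_l.+1 -> Delta m) (t : Delta l) c :
  c - set_val (affine v t) =
    \sum_j set_val t 0 j *: (c - set_val (v j)).
Proof.
under eq_bigr do rewrite scalerBr; rewrite sumrB -scaler_suml.
by rewrite simplex_sum1 scale1r.
Qed.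

Lemma ball_hull_affine l m (v : 'I_l.+1 -> Delta m) (t : Delta l) :
  ball_hull v (affine v t).
Proof.
move=> c r cr; rewrite sub_affine_row.
rewrite (le_trans (ler_norm_sum _ _ _))//.
rewrite -[leRHS]mul1r -(simplex_sum1 t) mulr_suml; apply: ler_sum => j _.
by rewrite normrZ ger0_norm ?simplex_ge0// ler_wpM2l ?simplex_ge0.
Qed.

(** In the average of the differences [v i - v j], the term [j = i] is zero; [l] terms of weight
    [1 / (l + 1)] remain. *)
Lemma barycenter_dist l m (v : 'I_l.+1 -> Delta m) (d : RR) i :
  mesh_le v d ->
  `|set_val (barycenter v) - set_val (v i)| <= l%:R / l.+1%:R * d.
Proof.
move=> vd; rewrite distrC sub_affine_row (bigD1 i)//= subrr scaler0 add0r.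
rewrite (le_trans (ler_norm_sum _ _ _))//.
rewrite (@le_trans _ _ (\sum_(j < l.+1 | j != i) (l.+1%:R^-1 * d)))//.
  apply: ler_sum => j _; rewrite normrZ !mxE ger0_norm ?invr_ge0//.
  by rewrite ler_wpM2l ?invr_ge0.
rewrite sumr_const cardC1 card_ord /= -[leLHS]mulr_natl.
by rewrite mulrA.
Qed.

(** The ratio [r] stays fixed while the induction lowers [l], as [l / (l + 1)] increases with [l].
    Recording that the pieces lie in the hull of [v] bounds their distance to the new apex. *)
Lemma subdivide_small (G : zmodType) (r d : RR) l m
    (c : @ordered_cochain G (Delta m) l) (v : 'I_l.+1 -> Delta m) :
  l%:R / l.+1%:R <= r -> 0 <= r -> 0 <= d -> mesh_le v d ->
  (forall w : 'I_l.+1 -> Delta m,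
     (forall j, ball_hull v (w j)) -> mesh_le w (r * d) -> c w = 0) ->
  subdivide (@barycenter RR m) c v = 0.
Proof.
move=> + r0 d0; elim: l c v => [|l IHl] c v lr vd c0 /=.
  apply: c0 => [j x h //|i j].
  by rewrite !ord1 subrr normr0 mulr_ge0.
rewrite /ocoboundary big1// => i _; rewrite IHl ?mul0rz//.
- apply: le_trans lr.
  rewrite ler_pdivrMr// mulrAC ler_pdivlMr// -!natrM ler_nat.
  by rewrite mulnS mulSn leq_add2r.
- by move=> j k; exact: vd.
move=> w vw wd; apply: c0.
  move=> j; rewrite /vcons; case: unliftP => [k _|_].
    by move=> x h xv; apply: vw => k'; exact: xv.
  exact: ball_hull_affine.
have bd (x : Delta m) : ball_hull (v \o lift i) x ->
    `|set_val (barycenter v) - set_val x| <= r * d.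
  move=> vx; apply: vx => k; apply: le_trans (barycenter_dist _ vd) _.
  by rewrite ler_wpM2r.
move=> j k; rewrite /vcons.
case: unliftP => [j' _|_]; case: unliftP => [k' _|_].
- exact: wd.
- by rewrite distrC bd.
- by rewrite bd.
- by rewrite subrr normr0 mulr_ge0.
Qed.

Lemma iter_subdivide_small (G : zmodType) (r d : RR) l m j
    (c : @ordered_cochain G (Delta m) l) (v : 'I_l.+1 -> Delta m) :
  l%:R / l.+1%:R <= r -> 0 <= r -> 0 <= d -> mesh_le v d ->
  (forall w : 'I_l.+1 -> Delta m, mesh_le w (r ^+ j * d) -> c w = 0) ->
  iter j (@subdivide G _ (@barycenter RR m) l) c v = 0.
Proof.
move=> lr r0 d0 vd; elim: j c => [|j IHj] c c0.
  by apply: c0; rewrite expr0 mul1r.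
rewrite iterSr; apply: IHj => w wd.
apply: (@subdivide_small G r (r ^+ j * d)) => //.
  by rewrite mulr_ge0 ?exprn_ge0.
by move=> u _ ud; apply: c0; rewrite exprS -mulrA.
Qed.

Lemma simplex_norm_le1 m (t : 'rV[RR]_m.+1) : Delta m t -> `|t| <= 1.
Proof.
move=> [t0 t1]; rewrite [leLHS]/Num.norm/= mx_normrE.
apply/bigmax_leP; split=> //= -[i j] _ /=; rewrite ord1 ger0_norm//.
by rewrite -t1 (bigD1 j)//= lerDl sumr_ge0.
Qed.

Lemma simplex_mesh_le2 l m (v : 'I_l.+1 -> Delta m) : mesh_le v 2.
Proof.
move=> i j; rewrite (le_trans (ler_normB _ _))// -[2]/(1 + 1) lerD//;
  apply: simplex_norm_le1; exact: set_valP.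
Qed.

Lemma simplex_compact m : compact (Delta m).
Proof.
apply: bounded_closed_compact.
  exists 1; split=> // x x1 t /simplex_norm_le1 t1.
  exact: le_trans t1 (ltW x1).
have -> : Delta m = (\bigcap_(j in [set: 'I_m.+1])
      [set t : 'rV[RR]_m.+1 | 0 <= t 0 j])
    `&` [set t : 'rV[RR]_m.+1 | \sum_j t 0 j = 1].
  apply/seteqP; split=> t [t0 t1]; split=> // j; first by move=> _; exact: t0.
  exact: t0 j I.
apply: closedI.
  apply: closed_bigI => j _.
  apply: (@preimage_closed _ _ (fun t : 'rV[RR]_m.+1 => t 0 j)
    [set x | 0 <= x]); last exact: closed_ge.
  by move=> t _; exact: coord_continuous.
apply: (@preimage_closed _ _ (fun t : 'rV[RR]_m.+1 => \sum_j t 0 j)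
  [set x | x = 1]); last exact: closed_eq.
move=> t _; move: t.
apply: continuous_big => [|j _]; first exact: add_continuous.
exact: coord_continuous.
Qed.

(** By the near-covering form of compactness it suffices to find, near each point, a radius that
    works for all nearby centres. *)
Lemma lebesgue_number2 (V : normedModType RR) (K A B : set V) :
  compact K -> open A -> open B -> K `<=` A `|` B ->
  exists2 e : RR, 0 < e & forall x, K x -> ball x e `<=` A \/ ball x e `<=` B.
Proof.
move=> /compact_near_coveringP cK oA oB KAB.
have near_open (O : set V) x : open O -> O x ->
    \forall x' \near x & e \near 0^'+, ball x' e `<=` O.
  move=> oO Ox.
  have /nbhs_ballP[d /= d0 dO] : nbhs x O by exact: open_nbhs_nbhs.
  near=> x' e.
  (* Half of [d] pays for moving the centre, half for the radius. *)
  have ed : e <= d / 2 by near: e; apply: nbhs_right_le; rewrite divr_gt0.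
  move=> y xy; apply: dO.
  rewrite [d]splitr; apply: (@ball_triangle _ _ x').
    by near: x'; apply: nbhsx_ballx; rewrite divr_gt0.
  exact: le_ball ed _ xy.
have := cK _ (0^'+ : set_system RR)
  (fun e x => ball x e `<=` A \/ ball x e `<=` B) _ _.
case.
  move=> x /KAB[Ax|Bx].
    by apply: filterS (near_open A x oA Ax) => e; left.
  by apply: filterS (near_open B x oB Bx) => e; right.
move=> e /= e0 he; exists (e / 2); first by rewrite divr_gt0.
move=> x Kx; apply: (he (e / 2)) => //=.
  by rewrite sub0r normrN gtr0_norm ?divr_gt0// ltr_pdivrMr// ltr_pMr// ltr1n.
by rewrite divr_gt0.
Unshelve. all: by end_near. Qed.

Definition inside (X : topologicalType) l (U : set X)
  (s : singular_simplex RR X l) : Prop := forall t, U (s t).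

Definition small (X : topologicalType) l (U V : set X)
  (s : singular_simplex RR X l) : Prop := inside U s \/ inside V s.

Lemma simplex_lebesgue (X : topologicalType) (U V : set X) m
    (s : singular_simplex RR X m) :
  open U -> open V -> U `|` V = [set: X] ->
  exists2 e : RR, 0 < e & forall l (w : 'I_l.+1 -> Delta m),
    mesh_le w e -> small U V (s \o affine w).
Proof.
move=> oU oV UV.
have [A oA AU] := open_preimage_val s oU.
have [B oB BV] := open_preimage_val s oV.
have [|e e0 he] := @lebesgue_number2 _ (Delta m) A B (@simplex_compact m) oA oB.
  move=> t Dt; pose t' : Delta m := exist _ t (mem_set Dt).
  have : (U `|` V) (s t') by rewrite UV.
  by move=> [/AU|/BV]; [left|right].
(* Halved because [mesh_le] is a weak inequality and the ball is open. *)
exists (e / 2); first by rewrite divr_gt0.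
move=> l w we.
have we' t : ball (set_val (w ord0)) e (set_val (affine w t)).
  rewrite -ball_normE /=; apply: le_lt_trans (_ : e / 2 < e).
    by apply: ball_hull_affine => i; exact: we.
  by rewrite ltr_pdivrMr// ltr_pMr// ltr1n.
have [wA|wB] := he _ (set_valP (w ord0)).
  by left => t; apply/AU; apply: wA; exact: we'.
by right => t; apply/BV; apply: wB; exact: we'.
Qed.

(** The bound depends on [s] but serves all affine simplices inside [s] at once, in particular its
    faces. *)
Lemma iter_sd_small (G : zmodType) (X : topologicalType) (U V : set X) l m
    (c : cochain RR X G l) (s : singular_simplex RR X m) :
  open U -> open V -> U `|` V = [set: X] ->
  (forall s', small U V s' -> c s' = 0) ->
  exists N, forall j, (N <= j)%N -> sharp s (iter j (@sd RR G X l) c) = 0.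
Proof.
move=> oU oV UV c0; have [e e0 he] := simplex_lebesgue s oU oV UV.
pose r : RR := l%:R / l.+1%:R.
have r0 : 0 <= r by rewrite divr_ge0.
have r1 : `|r| < 1 by rewrite ger0_norm// ltr_pdivrMr// mul1r ltr_nat.
(* The factor 2 is the bound of [simplex_mesh_le2] on the initial mesh. *)
have [N _ hN] : \forall j \near \oo, r ^+ j * 2 <= e.
  have /cvgrPdist_le/(_ (e / 2)) := cvg_expr r1.
  rewrite divr_gt0// => /(_ isT) [N _ hN]; exists N => // j /hN /=.
  rewrite sub0r normrN ger0_norm ?exprn_ge0// => h.
  by rewrite -ler_pdivlMr.
exists N => j Nj.
have -> : sharp s (iter j (@sd RR G X l) c) =
    iter j (@subdivide G _ (@barycenter RR m) l) (sharp s c).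
  by elim: j {Nj} => //= j <-; rewrite sharp_sd.
apply/funext => v; apply: (@iter_subdivide_small G r 2) => //.
  exact: simplex_mesh_le2.
move=> w wd; apply: c0; apply: he => i k.
exact: le_trans (wd i k) (hN _ Nj).
Qed.

End Mesh.

(** * Small simplices and gluing *)

Section SmallSimplices.
Context {RR : realType} {G : zmodType} {X : topologicalType}.
Variables (U V : set X).
Hypotheses (oU : open U) (oV : open V) (UV : U `|` V = [set: X]).
Local Notation cochain := (cochain RR X G).

Lemma inside_comp (W : set X) m k (s : singular_simplex RR X m)
    (a : continuousType (std_simplex RR k) (std_simplex RR m)) :
  inside W s -> inside W (s \o a : singular_simplex RR X k).
Proof. by move=> sW t; exact: sW. Qed.

Lemma small_comp m k (s : singular_simplex RR X m)
    (a : continuousType (std_simplex RR k) (std_simplex RR m)) :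
  small U V s -> small U V (s \o a : singular_simplex RR X k).
Proof. by move=> [] h; [left|right]; exact: inside_comp. Qed.

Lemma sd0 l : sd (0 : cochain l) = 0.
Proof.
apply/funext => s; have := subdivideB (@barycenter RR l)
  (sharp s (0 : cochain l)) (sharp s (0 : cochain l)).
by rewrite subrr => /(congr1 (fun c => c (@vertex RR l))); rewrite subrr.
Qed.

Lemma sd_homotopy_sharp0 l (c : cochain l.+1) s :
  sharp s c = 0 -> sd_homotopy c s = 0.
Proof.
rewrite /sd_homotopy => ->.
have := subdivision_homotopyB (@barycenter RR l)
  (0 : @ordered_cochain G (std_simplex RR l) l.+1) 0.
by rewrite subrr => ->; rewrite subrr.
Qed.

Lemma coboundary_iter_sd l (x : cochain l) j :
  coboundary x = 0 -> coboundary (iter j (@sd RR G X l) x) = 0.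
Proof.
by move=> x0; elim: j => //= j IHj; rewrite -sd_coboundary IHj sd0.
Qed.

(* With [T] the chain homotopy from [id] to [sd], [k] is the sum over j of the
   [T (sd^j x)], finite on each simplex by the Lebesgue number lemma. *)
Lemma small_simplices l (x : cochain l.+1) :
  coboundary x = 0 -> (forall s, small U V s -> x s = 0) ->
  exists2 k : cochain l, coboundary k = x & forall s, small U V s -> k s = 0.
Proof.
move=> dx x0; pose xs j := iter j (@sd RR G X l.+1) x.
pose good m (s : singular_simplex RR X m) n :=
  forall j, (n <= j)%N -> sharp s (xs j) = 0.
have ex_good m (s : singular_simplex RR X m) : exists n, good m s n.
  exact: (iter_sd_small s oU oV UV x0).
pose N s := sval (cid (ex_good l s)).
have NP s : good l s (N s) := svalP (cid (ex_good l s)).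
pose ks n s := \sum_(0 <= j < n) sd_homotopy (xs j) s.
have ks_stable s n n' : good l s n -> (n <= n')%N -> ks n' s = ks n s.
  move=> gn nn'; rewrite /ks (big_cat_nat (leq0n n) nn')//=.
  rewrite [X in _ + X]big_nat_cond.
  rewrite [X in _ + X]big1 ?addr0// => j /andP[/andP[nj _] _].
  by rewrite sd_homotopy_sharp0// gn.
have ks_good s n : good l s n -> ks (N s) s = ks n s.
  move=> gn; case: (leP (N s) n) => [Nn|/ltW nN].
    by rewrite (ks_stable s (N s)).
  by rewrite (ks_stable s n).
exists (fun s => ks (N s) s).
  apply/funext => s; have [n gn] := ex_good _ s.
  (* A bound valid for [s] is valid for its faces, so the coboundary at [s] can be computed with one
     common truncation. *)
  have gface i : good l (s \o face RR i) n.
    by move=> j nj; rewrite face_affineE sharp_affine gn.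
  transitivity (\sum_(0 <= j < n) coboundary (sd_homotopy (xs j)) s).
    rewrite /coboundary exchange_big; apply: eq_bigr => i _ /=.
    by rewrite -mulrz_suml (ks_good _ _ (gface i)).
  under eq_bigr => j _ do rewrite coboundary_sd_homotopy coboundary_iter_sd//.
  have sdh0 : sd_homotopy (0 : cochain l.+2) = 0.
    by apply/funext => s'; apply: sd_homotopy_sharp0.
  rewrite sdh0; under eq_bigr => j _ do
    rewrite subr0 -[(_ - _) s]/(xs j s - xs j.+1 s) -opprB.
  (* The sum of the [xs j - xs j.+1] telescopes to [x - xs n], and [xs n] vanishes on [s]. *)
  rewrite sumrN telescope_sumr// opprB.
  by rewrite -[xs n s]sharp_vertices gn// subr0.
move=> s sm; rewrite /ks big1// => j _; apply: sd_homotopy_sharp0.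
suff xs0 i s' : small U V s' -> xs i s' = 0.
  by apply/funext => v; apply: xs0; exact: small_comp.
elim: i s' => [|i IHi] s' sm'; first exact: x0.
rewrite /xs /= /sd.
have -> : sharp s' (xs i) = 0.
  by apply/funext => v; apply: IHi; exact: small_comp.
have := subdivideB (@barycenter RR l.+1)
  (0 : @ordered_cochain G (std_simplex RR l.+1) l.+1) 0.
by rewrite subrr => ->; rewrite subrr.
Qed.

Lemma coboundaryN l (c : cochain l) : coboundary (- c) = - coboundary c.
Proof. by rewrite -[- c]sub0r coboundaryB coboundary0 sub0r. Qed.

Lemma coboundary_propB l (c d : cochain l) :
  coboundary_prop c -> coboundary_prop d -> coboundary_prop (c - d).
Proof.
case: l c d => [|l] c d /=; first by move=> -> ->; rewrite subrr.
by move=> [b ->] [b' ->]; exists (b - b'); rewrite coboundaryB.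
Qed.

Lemma coboundary_propN l (c : cochain l) :
  coboundary_prop c -> coboundary_prop (- c).
Proof.
move=> hc; rewrite -[- c]sub0r; apply: coboundary_propB => //.
by case: l {c hc} => //= l; exists 0; rewrite coboundary0.
Qed.

End SmallSimplices.

Section Subspaces.
Context {RR : realType} {G : zmodType} {X : topologicalType}.
Local Notation cochain X := (cochain RR X G).
Implicit Types U V : set X.

Lemma corestrict_subproof (Y : topologicalType) U (f : continuousType Y X)
    (fU : forall y, U (f y)) :
  continuous (fun y => exist _ (f y) (mem_set (fU y)) : U).
Proof. by apply/continuous_comp_initial => y; exact: cts_fun. Qed.

Definition corestrict (Y : topologicalType) U (f : continuousType Y X)
    (fU : forall y, U (f y)) :
  continuousType Y U := mkcts (@corestrict_subproof Y U f fU).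

Definition subset_incl U V (UV : U `<=` V) : continuousType U V :=
  corestrict (U := V) (f := subspace_incl U) (fun x => UV _ (set_valP x)).

Lemma insideP U m (s : singular_simplex RR X m) :
  inside U s ->
  exists s' : singular_simplex RR U m, s = subspace_incl U \o s'.
Proof. by move=> sU; exists (corestrict sU); apply/continuousEP. Qed.

Lemma inside_incl U m (s : singular_simplex RR U m) :
  inside U (subspace_incl U \o s : singular_simplex RR X m).
Proof. by move=> t; exact: set_valP. Qed.

Lemma pull_eq U m (c d : cochain X m) :
  pull_cochain (subspace_incl U) c = pull_cochain (subspace_incl U) d <->
  forall s, inside U s -> c s = d s.
Proof.
split=> [cd s /insideP[s' ->]|cd].
  exact: (congr1 (fun c => c s') cd).
by apply/funext => s; apply: cd; exact: inside_incl.
Qed.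

(** Only the values inside [U] are meaningful: on simplices leaving [U], the coboundary of an
    extension need not be zero. *)
Definition extend U m (c : cochain U m) : cochain X m := fun s =>
  if pselect (inside U s) is left sU then c (corestrict sU) else 0.

Lemma extend_pull U m (c : cochain U m) :
  pull_cochain (subspace_incl U) (extend c) = c.
Proof.
apply/funext => s; rewrite /pull_cochain /extend.
case: pselect => [sU|[]]; last exact: inside_incl.
by congr c; apply/continuousEP => t; exact/val_inj.
Qed.

(** Correcting [y] by a coboundary makes it agree with [z] on the intersection. The two then glue to
    a cochain whose coboundary is [x] on small simplices, and [small_simplices] removes the
    remaining error. *)
Lemma glue_coboundary U V m (x : cochain X m.+1) (y z : cochain X m) :
  open U -> open V -> U `|` V = [set: X] ->
  coboundary x = 0 ->
  (forall s, inside U s -> x s = coboundary y s) ->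
  (forall s, inside V s -> x s = coboundary z s) ->
  coboundary_prop (pull_cochain (subspace_incl (U `&` V)) (y - z)) ->
  exists b, x = coboundary b.
Proof.
move=> oU oV UV dx xy xz yz.
have [y' dy' y'z] : exists2 y' : cochain X m, coboundary y' = coboundary y &
    forall s, inside (U `&` V) s -> y' s = z s.
  case: m x y z dx xy xz yz => [|m] x y z dx xy xz /=.
    move=> yz; exists y => // s sUV; apply/eqP; rewrite -subr_eq0; apply/eqP.
    have [s' ->] := insideP sUV.
    exact: (congr1 (fun c => c s') yz).
  move=> [b yzb]; exists (y - coboundary (extend b)).
    by rewrite coboundaryB coboundaryK subr0.
  move=> s sUV; apply/eqP; rewrite -[(_ - _) s]/(y s - coboundary _ s).
  rewrite subr_eq addrC -subr_eq -[_ - _]/((y - z) s); apply/eqP; move: s sUV.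
  apply/pull_eq; rewrite yzb -pull_coboundary extend_pull//.
(* On simplices inside neither set the value is arbitrary; the correction [k] compensates. *)
pose w : cochain X m := fun s => if `[< inside U s >] then y' s else z s.
have wy s : inside U s -> w s = y' s by move=> sU; rewrite /w asboolT.
have wz s : inside V s -> w s = z s.
  rewrite /w; case: asboolP => // sU sV; apply: y'z => t.
  by split; [exact: sU|exact: sV].
have [||k dk _] := @small_simplices RR G X U V oU oV UV _ (coboundary w - x).
- by rewrite coboundaryB coboundaryK dx subr0.
- move=> s sm; rewrite -[(_ - _) s]/(coboundary w s - x s).
  case: sm => [sU|sV].
    rewrite xy// -dy'; apply/eqP; rewrite subr_eq0; apply/eqP.
    by apply: eq_bigr => i _; congr (_ *~ _); apply: wy; exact: inside_comp.
  rewrite xz//; apply/eqP; rewrite subr_eq0; apply/eqP.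
  by apply: eq_bigr => i _; congr (_ *~ _); apply: wz; exact: inside_comp.
by exists (w - k); rewrite coboundaryB dk subKr.
Qed.

End Subspaces.

(** * Homotopy invariance *)

Section Pairing.
Variables (X Y Z : topologicalType).

Lemma pair_fun_continuous (f : continuousType X Y) (g : continuousType X Z) :
  continuous (fun x => (f x, g x)).
Proof. by move=> x; apply: cvg_pair => /=; exact: cts_fun. Qed.

Definition pair_map (f : continuousType X Y) (g : continuousType X Z) :
  continuousType X (Y * Z)%type := mkcts (@pair_fun_continuous f g).

Lemma fst_continuous : continuous (@fst X Y).
Proof. by move=> x; exact: cvg_fst. Qed.

Lemma snd_continuous : continuous (@snd X Y).
Proof. by move=> x; exact: cvg_snd. Qed.

Definition fst_map : continuousType (X * Y)%type X := mkcts fst_continuous.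
Definition snd_map : continuousType (X * Y)%type Y := mkcts snd_continuous.

End Pairing.

Section Prism.
Context {RR : realType} {G : zmodType}.
Local Notation Delta := (std_simplex RR).
Local Notation I := (unit_interval RR).
Local Notation cochain X := (cochain RR X G).

Lemma simplex_coord_itv m (t : Delta m) j : unit_interval RR (set_val t 0 j).
Proof.
rewrite /unit_interval/= in_itv/= simplex_ge0 -(simplex_sum1 t) (bigD1 j)//=.
by rewrite lerDl sumr_ge0// => k _; exact: simplex_ge0.
Qed.

Definition edge_fun (t : Delta 1) : I :=
  exist _ (set_val t 0 ord_max) (mem_set (simplex_coord_itv t ord_max)).

Lemma edge_fun_continuous : continuous edge_fun.
Proof.
by apply/continuous_comp_initial; exact: simplex_coord_continuous.
Qed.

Definition edge : continuousType (Delta 1) I := mkcts edge_fun_continuous.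

Section Homotopy.
Context {X Y : topologicalType}.

Definition at_time (H : continuousType (X * I)%type Y) (r : I) :
  continuousType X Y := H \o pair_map idfun (cst r).

Lemma at_timeE H r x : at_time H r x = H (x, r).
Proof. by []. Qed.

Variable H : continuousType (X * I)%type Y.

(** The tuple [v] spans an affine simplex in the prism, which [s], [edge] and [H] carry to [Y]. *)
Definition prism_simplex m (s : singular_simplex RR X m) l
    (v : 'I_l.+1 -> Delta m * Delta 1) : singular_simplex RR Y l :=
  H \o pair_map (s \o affine (fst \o v)) (edge \o affine (snd \o v)).

Definition prism_sharp m (s : singular_simplex RR X m) l (c : cochain Y l) :
  @ordered_cochain G (Delta m * Delta 1) l := fun v => c (prism_simplex s v).

Lemma prism_sharp_coboundary m (s : singular_simplex RR X m) l
    (c : cochain Y l) :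
  prism_sharp s (coboundary c) = ocoboundary (prism_sharp s c).
Proof.
apply/funext => v; apply: eq_bigr => i _; congr (c _ *~ _).
apply/continuousEP => t.
rewrite -[LHS]/(H (s (affine (fst \o v) (face RR i t)),
  edge (affine (snd \o v) (face RR i t)))).
by rewrite !affine_face.
Qed.

Definition times (K L : Type) (a : K -> L) (p : K * Delta 1) : L * Delta 1 :=
  (a p.1, p.2).

Lemma prism_sharp_affine m k (s : singular_simplex RR X m)
    (w : 'I_k.+1 -> Delta m) l (c : cochain Y l) :
  prism_sharp (s \o affine w) c = opull (times (affine w)) (prism_sharp s c).
Proof.
apply/funext => v; congr c; apply/continuousEP => t.
rewrite -[LHS]/(H (s (affine w (affine (fst \o v) t)),
  edge (affine (snd \o v) t))).
by rewrite affine_affine.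
Qed.

Definition end_tuple (K : Type) (e : Delta 1) l
    (c : @ordered_cochain G (K * Delta 1) l) : @ordered_cochain G K l :=
  opull (fun x => (x, e)) c.

(** Since the prism is convex, any apex compatible with affine maps gives a homotopy. *)
Definition prism_apex m l (v : 'I_l.+1 -> Delta m) : Delta m * Delta 1 :=
  (barycenter v, vertex ord0).

Definition prism_homotopy m l :=
  cone_homotopy (G := G) (end_tuple (vertex ord_max)) (end_tuple (vertex ord0))
    (@prism_apex m) (l := l).

Definition prism l (c : cochain Y l.+1) : cochain X l :=
  fun s => @prism_homotopy l l (prism_sharp s c) (@vertex RR l).

Lemma sharp_prism m (s : singular_simplex RR X m) l (c : cochain Y l.+1) :
  sharp s (prism c) = @prism_homotopy m l (prism_sharp s c).
Proof.
apply/funext => v; rewrite /sharp /prism prism_sharp_affine /prism_homotopy.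
rewrite (@cone_homotopy_opull _ _ _ _ _ (affine v) (times (affine v))
  _ _ (end_tuple (vertex ord_max)) (end_tuple (vertex ord0))
  _ (@prism_apex m))//.
- by congr cone_homotopy; apply/funext => j /=; rewrite affine_vertex.
- by move=> k w; rewrite /times /= affine_barycenter.
Qed.

Lemma prism_sharp_end m (s : singular_simplex RR X m) (j : 'I_2) (r : I) l
    (c : cochain Y l) :
  r = edge (vertex j) ->
  end_tuple (vertex j) (prism_sharp s c) =
  sharp s (pull_cochain (at_time H r) c).
Proof.
move=> ->; apply/funext => v; congr c; apply/continuousEP => t /=.
congr (H (_, edge _)); apply: simplex_eqP => k; rewrite affineE /=.
by rewrite -mulr_suml simplex_sum1 mul1r.
Qed.

Lemma edge0 : I0 RR = edge (vertex ord0).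
Proof. by apply/val_inj; rewrite /= mxE. Qed.

Lemma edge1 : I1 RR = edge (vertex ord_max).
Proof. by apply/val_inj; rewrite /= mxE !eqxx. Qed.

Lemma prism_pt (c : cochain Y 0) :
  prism (coboundary c) =
  pull_cochain (at_time H (I1 RR)) c - pull_cochain (at_time H (I0 RR)) c.
Proof.
apply/funext => s; rewrite /prism prism_sharp_coboundary.
rewrite /prism_homotopy cone_homotopy_pt//.
rewrite (prism_sharp_end _ _ edge0) (prism_sharp_end _ _ edge1).
by rewrite ocochainBE !sharp_vertices.
Qed.

Lemma prism_coboundary l (c : cochain Y l.+1) :
  prism (coboundary c) =
  pull_cochain (at_time H (I1 RR)) c - pull_cochain (at_time H (I0 RR)) c -
  coboundary (prism c).
Proof.
apply/funext => s; rewrite -[RHS]sharp_vertices /prism prism_sharp_coboundary.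
rewrite /prism_homotopy cone_homotopyP//.
rewrite (prism_sharp_end _ _ edge0) (prism_sharp_end _ _ edge1).
set p1 := pull_cochain _ c; set p0 := pull_cochain _ c.
rewrite -[sharp s (_ - _)]/(sharp s p1 - sharp s p0 -
  sharp s (coboundary (prism c))).
by rewrite sharp_coboundary sharp_prism.
Qed.

(** Stated for arbitrary cochains because it is applied to primitives, which are not cocycles; there
    the term [prism (coboundary c)] is identified separately. *)
Lemma prism_homotopic l (c : cochain Y l) :
  coboundary_prop (pull_cochain (at_time H (I1 RR)) c -
    pull_cochain (at_time H (I0 RR)) c - prism (coboundary c)).
Proof.
case: l c => [|l] c /=; first by rewrite prism_pt subrr.
by exists (prism c); rewrite prism_coboundary subKr.
Qed.

End Homotopy.

Lemma prism_comp (X Y Z : topologicalType) (H : continuousType (X * I)%type Y)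
    (h : continuousType Y Z) l (c : cochain Z l.+1) :
  prism (h \o H) c = prism H (pull_cochain h c).
Proof.
apply/funext => s; rewrite /prism /prism_homotopy; congr cone_homotopy.
apply/funext => v; congr c; exact/continuousEP.
Qed.

Definition restrict_homotopy (W X Y : topologicalType) (i : continuousType W X)
    (H : continuousType (X * I)%type Y) : continuousType (W * I)%type Y :=
  H \o pair_map (i \o fst_map W I) (snd_map W I).

Lemma prism_restrict (W X Y : topologicalType) (i : continuousType W X)
    (H : continuousType (X * I)%type Y) l (c : cochain Y l.+1) :
  prism (restrict_homotopy i H) c = pull_cochain i (prism H c).
Proof.
apply/funext => s; rewrite /pull_cochain /prism /prism_homotopy.
congr cone_homotopy; apply/funext => v; congr c; exact/continuousEP.
Qed.

End Prism.

Definition quotient_map (X Y : topologicalType) (q : continuousType X Y) :=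
  forall O : set Y, open (q @^-1` O) -> open O.

Lemma quotient_map_comp (X Y Z : topologicalType) (q : continuousType X Y)
    (r : continuousType Y Z) :
  quotient_map q -> quotient_map r ->
  quotient_map (r \o q : continuousType X Z).
Proof. by move=> hq hr O oO; apply: hr; exact: hq. Qed.

Section Collapse.
Variables (X : topologicalType) (A : set X).

Lemma collapse_mapP (x y : X) :
  collapse_map A x = collapse_map A y <-> x = y \/ A x /\ A y.
Proof.
split=> [/(@eqmodP _ (collapse_rel A))/asboolP//|h].
exact/(@eqmodP _ (collapse_rel A))/asboolP.
Qed.

Lemma collapse_map_surj (y : collapse A) : exists x, collapse_map A x = y.
Proof. by exists (repr y); exact: reprK. Qed.

Lemma collapse_map_quotient : quotient_map (collapse_map A).
Proof. by []. Qed.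

End Collapse.

(** * Cones and suspensions *)

Section Cylinder.
Context {RR : realType}.
Local Notation I := (unit_interval RR).

Lemma itv_ge0 (s : I) : 0 <= set_val s.
Proof. by have := set_valP s; rewrite /unit_interval/= in_itv => /andP[]. Qed.

Lemma itv_le1 (s : I) : set_val s <= 1.
Proof. by have := set_valP s; rewrite /unit_interval/= in_itv => /andP[]. Qed.

Lemma set_val_I0 : set_val (I0 RR) = 0. Proof. by []. Qed.
Lemma set_val_I1 : set_val (I1 RR) = 1. Proof. by []. Qed.

Lemma itv_eqP (s t : I) : set_val s = set_val t -> s = t.
Proof. exact: val_inj. Qed.

(* Quotients of a cylinder [Z * I] in which the points at heights in [good] are
   not identified with any other point. *)
Section Quotient.
Variables (Z Q : topologicalType) (q : continuousType (Z * I)%type Q).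
Hypothesis q_quotient : quotient_map q.
Hypothesis q_surj : forall y, exists x, q x = y.
Variable good : set RR.
Hypothesis good_open : open good.
Hypothesis q_inj : forall x y, q x = q y ->
  x.2 = y.2 /\ (good (set_val x.2) -> x.1 = y.1).

Definition height (y : Q) : RR := set_val (sval (cid (q_surj y))).2.
(** Depends on a chosen preimage, and is canonical only at heights in [good]. *)
Definition shadow (y : Q) : Z := (sval (cid (q_surj y))).1.

Lemma heightE x : height (q x) = set_val x.2.
Proof.
rewrite /height; case: cid => y /= /q_inj[-> //].
Qed.

Lemma shadowE x : good (set_val x.2) -> shadow (q x) = x.1.
Proof.
by rewrite /shadow; case: cid => y /= /q_inj[xy2 xy1] gx; rewrite xy1// xy2.
Qed.

Lemma height_continuous : continuous height.
Proof.
apply/continuousP => O oO; apply: q_quotient.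
rewrite (_ : _ @^-1` _ = (set_val \o @snd Z I) @^-1` O); last first.
  by apply/seteqP; split=> x /=; rewrite heightE.
apply: open_comp oO => x _; apply: (@continuous_comp (Z * I)%type I RR).
  exact: snd_continuous.
exact: continuous_set_val.
Qed.

Lemma shadow_continuous (T : topologicalType) (f : continuousType T Q) :
  (forall t, good (height (f t))) -> continuous (shadow \o f).
Proof.
move=> gf; apply/continuousP => O oO.
(* The condition on the height holds along [f], and makes the preimage of [B] under [q] an
   intersection of two open sets. *)
pose B := [set y | good (height y) /\ O (shadow y)].
rewrite (_ : _ @^-1` _ = f @^-1` B); last first.
  by apply/seteqP; split=> t //= [].
apply: open_comp => [t _|]; first exact: cts_fun.
apply: q_quotient.
rewrite (_ : _ @^-1` _ = fst @^-1` O `&` (set_val \o snd) @^-1` good).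
  apply: openI; first by apply: open_comp => // x _; exact: fst_continuous.
  apply: open_comp => // x _; apply: (@continuous_comp (Z * I)%type I RR).
    exact: snd_continuous.
  exact: continuous_set_val.
apply/seteqP; split=> x; rewrite /B /= heightE.
  by move=> [gx]; rewrite shadowE.
by move=> [Ox gx]; rewrite shadowE.
Qed.

End Quotient.

Section ConeSuspension.
Variable Z : topologicalType.

Definition cone_map : continuousType (Z * I)%type (cone RR Z) :=
  collapse_map [set p : Z * I | p.2 = I0 RR].

Definition susp_map : continuousType (Z * I)%type (suspension RR Z) :=
  cone_to_suspension RR Z \o cone_map.

Lemma cone_mapP x y :
  cone_map x = cone_map y <-> x = y \/ x.2 = I0 RR /\ y.2 = I0 RR.
Proof. exact: collapse_mapP. Qed.

Lemma cone_baseE z : cone_base RR Z z = cone_map (z, I1 RR).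
Proof. by []. Qed.

Lemma cone_map_base x : range (cone_base RR Z) (cone_map x) <-> x.2 = I1 RR.
Proof.
split=> [[z _]|]; last by case: x => z s /= ->; exists z.
rewrite cone_baseE => /cone_mapP[<- //|[/= /(congr1 set_val)]].
by rewrite set_val_I0 set_val_I1 => /eqP; rewrite oner_eq0.
Qed.

Lemma susp_mapP x y : susp_map x = susp_map y <->
  [\/ x = y, x.2 = I0 RR /\ y.2 = I0 RR | x.2 = I1 RR /\ y.2 = I1 RR].
Proof.
split=> [/collapse_mapP[/cone_mapP[->|?]|[/cone_map_base ? /cone_map_base ?]]|].
- exact: Or31.
- exact: Or32.
- exact: Or33.
case=> [-> //|h|[/cone_map_base hx /cone_map_base hy]].
  by congr (cone_to_suspension RR Z _); apply/cone_mapP; right.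
by apply/collapse_mapP; right.
Qed.

Lemma cone_map_surj y : exists x, cone_map x = y.
Proof. exact: collapse_map_surj. Qed.

Lemma susp_map_surj y : exists x, susp_map x = y.
Proof.
have [c <-] := collapse_map_surj y; have [x <-] := cone_map_surj c.
by exists x.
Qed.

(* Computing implicit arguments would unfold [open] in these statements, which
   takes very long. *)
Unset Implicit Arguments.
Lemma cone_map_quotient : quotient_map cone_map.
Proof. exact: collapse_map_quotient. Qed.

Lemma susp_map_quotient : quotient_map susp_map.
Proof.
apply: quotient_map_comp; first exact: cone_map_quotient.
exact: collapse_map_quotient.
Qed.

Set Implicit Arguments.

Definition cone_good : set RR := [set s | 0 < s].
Definition susp_good : set RR := [set s | 0 < s < 1].

Lemma cone_map_inj x y : cone_map x = cone_map y ->
  x.2 = y.2 /\ (cone_good (set_val x.2) -> x.1 = y.1).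
Proof.
move=> /cone_mapP[-> //|[-> ->]]; split=> //.
by rewrite /cone_good/= set_val_I0 ltxx.
Qed.

Lemma susp_map_inj x y : susp_map x = susp_map y ->
  x.2 = y.2 /\ (susp_good (set_val x.2) -> x.1 = y.1).
Proof.
move=> /susp_mapP[-> //|[-> ->]|[-> ->]]; split=> //.
  by rewrite /susp_good/= set_val_I0 ltxx.
by rewrite /susp_good/= set_val_I1 ltxx andbF.
Qed.

Lemma cone_good_open : open cone_good. Proof. exact: open_gt. Qed.

Lemma susp_good_open : open susp_good.
Proof.
rewrite (_ : susp_good = [set s | 0 < s] `&` [set s | s < 1]).
  by apply: openI; [exact: open_gt|exact: open_lt].
apply/seteqP; split=> s; rewrite /susp_good /=; first by move=> /andP[].
by move=> [-> ->].
Qed.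

End ConeSuspension.

(** Where [e t] lies in [W], an open condition, [f] is a composite of continuous maps; elsewhere it
    is locally constant. This handles maps that are extended past [W] by an arbitrary choice of
    point. *)
Lemma patch_continuous (T A Y : topologicalType) (W : set A)
    (e : continuousType T A) (h : continuousType T I)
    (q : continuousType (W * I)%type Y) (f : T -> Y) :
  open W ->
  (forall t (w : W (e t)), f t = q (exist _ (e t) (mem_set w), h t)) ->
  (forall t, ~ W (e t) -> \forall t' \near t, f t' = f t) ->
  continuous f.
Proof.
move=> oW fW fC t; have [w|nw] := pselect (W (e t)); last first.
  apply: cvg_near_cst; exact: fC.
pose T1 : set T := e @^-1` W.
have oT1 : open T1 by apply: open_comp => // x _; exact: cts_fun.
pose e1 : continuousType T1 W :=
  corestrict (U := W) (f := e \o subspace_incl T1) (fun x => set_valP x).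
pose g : continuousType T1 Y := q \o pair_map e1 (h \o subspace_incl T1).
have fg (x : T1) : f (set_val x) = g x.
  rewrite (fW _ (set_valP x)); congr (q (_, _)); exact/val_inj.
move=> O /= nO.
pose t1 : T1 := exist _ t (mem_set w : t \in T1).
have gO : nbhs (g t1) O by rewrite -fg.
have [_ [[P oP <-] Pt PO]] := @cts_fun _ _ g t1 O gO.
apply: filterS (open_nbhs_nbhs (conj (openI oT1 oP) (conj w Pt))) => x [xW xP].
pose x1 : T1 := exist _ x (mem_set xW : x \in T1).
by have : O (g x1) := PO x1 xP; rewrite -fg.
Qed.

(* The topology of the cone at its apex is finer than that of the product, so
   maps to the cone are made constant near the ends of the interval. *)
Lemma clamp_subproof (s : I) :
  unit_interval RR (Num.max 0 (Num.min 1 (3 * set_val s - 1))).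
Proof.
rewrite /unit_interval/= in_itv/= le_max lexx /= ge_max ler01 /=.
by rewrite ge_min lexx.
Qed.

Lemma clamp_continuous :
  continuous (fun s : I => Num.max 0 (Num.min 1 (3 * set_val s - 1))).
Proof.
apply: max_fun_continuous; first exact: cst_continuous.
apply: min_fun_continuous; first exact: cst_continuous.
move=> s; exact: (cvgB (cvgM (cvg_cst (3 : RR)) (@continuous_set_val _ I s))
  (cvg_cst (1 : RR))).
Qed.

(** Stretches the interval from 1/3 to 2/3, where the cylinder lies over both open sets, onto the
    unit interval. *)
Definition clamp : continuousType I I :=
  corestrict (f := mkcts clamp_continuous) clamp_subproof.

Lemma clampE s : set_val (clamp s) = Num.max 0 (Num.min 1 (3 * set_val s - 1)).
Proof. by []. Qed.

Lemma clamp_lt1 s : set_val s < 2 / 3 -> set_val (clamp s) < 1.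
Proof.
by move=> h; rewrite clampE gt_max ltr01 /= gt_min ltxx /=; lra.
Qed.

Lemma clamp_eq1 s : 2 / 3 <= set_val s -> clamp s = I1 RR.
Proof.
move=> h; apply: itv_eqP; rewrite clampE set_val_I1 min_l; last lra.
by rewrite max_r// ler01.
Qed.

Lemma clamp_gt0 s : 1 / 3 < set_val s -> 0 < set_val (clamp s).
Proof.
by move=> h; rewrite clampE lt_max lt_min ltr01 /=; apply/orP; right; lra.
Qed.

Lemma clamp_eq0 s : set_val s <= 1 / 3 -> clamp s = I0 RR.
Proof.
move=> h; apply: itv_eqP; rewrite clampE set_val_I0 max_l//.
by rewrite ge_min; apply/orP; right; lra.
Qed.

Lemma itv_max_subproof (s t : I) :
  unit_interval RR (Num.max (set_val s) (set_val t)).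
Proof.
by rewrite /unit_interval/= in_itv/= le_max itv_ge0 ge_max !itv_le1.
Qed.

Lemma itv_max_continuous :
  continuous (fun p : I * I => Num.max (set_val p.1) (set_val p.2)).
Proof.
apply: max_fun_continuous => p.
  by apply: (@continuous_comp (I * I)%type I RR);
    [exact: fst_continuous|exact: continuous_set_val].
by apply: (@continuous_comp (I * I)%type I RR);
  [exact: snd_continuous|exact: continuous_set_val].
Qed.

(** As the second argument runs from 0 to 1, this raises every height to 1 and fixes the height 1
    throughout. *)
Definition itv_max : continuousType (I * I)%type I :=
  corestrict (f := mkcts itv_max_continuous)
    (fun p => itv_max_subproof p.1 p.2).

Lemma itv_maxE s t :
  set_val (itv_max (s, t)) = Num.max (set_val s) (set_val t).
Proof. by []. Qed.

Lemma itv_max0 s : itv_max (s, I0 RR) = s.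
Proof. by apply: itv_eqP; rewrite itv_maxE max_l// itv_ge0. Qed.

Lemma itv_max1r s : itv_max (s, I1 RR) = I1 RR.
Proof. by apply: itv_eqP; rewrite itv_maxE max_r// itv_le1. Qed.

Lemma itv_max1l s : itv_max (I1 RR, s) = I1 RR.
Proof. by apply: itv_eqP; rewrite itv_maxE max_l// itv_le1. Qed.

End Cylinder.

Section CochainExtension.
Context {RR : realType} {G : zmodType} {X : topologicalType}.
Local Notation cochain X := (cochain RR X G).

Lemma coboundary_inside (U : set X) m (c d : cochain X m) :
  (forall s, inside U s -> c s = d s) ->
  forall s, inside U s -> coboundary c s = coboundary d s.
Proof.
move=> cd s sU; apply: eq_bigr => i _; congr (_ *~ _).
by apply: cd; exact: inside_comp.
Qed.

Lemma extendE (U : set X) m (c : cochain U m) (s : singular_simplex RR U m) :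
  extend c (subspace_incl U \o s) = c s.
Proof. by rewrite -[RHS](congr1 (@^~ s) (extend_pull c)). Qed.

Lemma extend_out (U : set X) m (c : cochain U m) (s : singular_simplex RR X m) :
  ~ inside U s -> extend c s = 0.
Proof. by rewrite /extend; case: pselect. Qed.

Lemma coboundary_extend (U : set X) m (c : cochain U m)
    (s : singular_simplex RR U m.+1) :
  coboundary (extend c) (subspace_incl U \o s) = coboundary c s.
Proof.
rewrite -[in RHS](extend_pull c) pull_coboundary.
by congr coboundary; exact/continuousEP.
Qed.

Lemma coboundary_prop_pull (Y : topologicalType) (f : continuousType Y X) m
    (c : cochain X m) : coboundary_prop c -> coboundary_prop (pull_cochain f c).
Proof.
case: m c => [|m] c /=; first by move=> ->.
by move=> [b ->]; exists (pull_cochain f b); rewrite pull_coboundary.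
Qed.

Lemma pull_cochainB (Y : topologicalType) (f : continuousType Y X) m
    (c d : cochain X m) :
  pull_cochain f (c - d) = pull_cochain f c - pull_cochain f d.
Proof. by []. Qed.

Lemma pull_cochain_comp (Y Z : topologicalType) (f : continuousType Y X)
    (g : continuousType Z Y) m (c : cochain X m) :
  pull_cochain g (pull_cochain f c) = pull_cochain (f \o g) c.
Proof. by apply/funext => s; congr c; exact/continuousEP. Qed.

Lemma eq_pull_cochain (Y : topologicalType) (f g : continuousType Y X) m
    (c : cochain X m) : f =1 g -> pull_cochain f c = pull_cochain g c.
Proof. by move=> /continuousEP ->. Qed.

Lemma coboundary_incl_sub (U V : set X) m (a : cochain X m.+1)
    (bU bV : cochain X m) :
  (forall s, inside U s -> a s = coboundary bU s) ->
  (forall s, inside V s -> a s = coboundary bV s) ->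
  coboundary (pull_cochain (subspace_incl (U `&` V)) (bU - bV)) = 0.
Proof.
move=> aU aV; rewrite pull_coboundary coboundaryB; apply/funext => s.
rewrite /pull_cochain; set s' := _ \o s.
rewrite -[LHS]/(coboundary bU s' - coboundary bV s').
rewrite -aU; last by move=> t; have [] := set_valP (s t).
by rewrite -aV ?subrr// => t; have [] := set_valP (s t).
Qed.

End CochainExtension.

(** * The double mapping cylinder *)

Section DoubleMappingCylinder.
Context {RR : realType} {A : topologicalType}.
Local Notation I := (unit_interval RR).
Variables (U V : set A).
Hypotheses (oU : open U) (oV : open V).
Local Notation W := (U `&` V).
Variable z0 : W.

Lemma near_itv_gt (T : topologicalType) (h : continuousType T I) t (c : RR) :
  c < set_val (h t) -> \forall t' \near t, c < set_val (h t').
Proof.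
move=> ct; have o : open [set x : I | c < set_val x].
  apply: (@open_comp I RR set_val [set x | c < x]); last exact: open_gt.
  by move=> x _; exact: continuous_set_val.
exact: (@cts_fun _ _ h t _ (open_nbhs_nbhs (conj o ct))).
Qed.

Lemma near_itv_lt (T : topologicalType) (h : continuousType T I) t (c : RR) :
  set_val (h t) < c -> \forall t' \near t, set_val (h t') < c.
Proof.
move=> ct; have o : open [set x : I | set_val x < c].
  apply: (@open_comp I RR set_val [set x | x < c]); last exact: open_lt.
  by move=> x _; exact: continuous_set_val.
exact: (@cts_fun _ _ h t _ (open_nbhs_nbhs (conj o ct))).
Qed.

(** Not continuous. The default [z0] is harmless where the height is 0 or 1 and the target collapses
    that level. *)
Definition pick_point (a : A) : W :=
  if pselect (W a) is left w then exist _ a (mem_set w) else z0.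

Lemma pick_pointE a : W a -> set_val (pick_point a) = a.
Proof. by rewrite /pick_point; case: pselect. Qed.

Lemma pick_point_val (w : W) : pick_point (set_val w) = w.
Proof. by apply/val_inj; apply: pick_pointE; exact: set_valP. Qed.

Lemma over_continuous (T Y : topologicalType) (e : continuousType T A)
    (h : continuousType T I) (q : continuousType (W * I)%type Y) :
  (forall t, ~ W (e t) -> \forall t' \near t,
     q (pick_point (e t'), h t') = q (pick_point (e t), h t)) ->
  continuous (fun t => q (pick_point (e t), h t)).
Proof.
move=> near_cst.
apply: (@patch_continuous RR T A Y W e h q) near_cst; first exact: openI.
by move=> t w; congr (q (_, _)); apply/val_inj; apply: pick_pointE.
Qed.

(* The double mapping cylinder of [U <- W -> V], with the copies of [U] and [V]
   thickened so that the collapsing map to the suspension is continuous. *)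
Definition cylinder : set (A * I) :=
  [set x | (set_val x.2 <= 2 / 3 -> U x.1) /\ (1 / 3 <= set_val x.2 -> V x.1)].

Definition cyl_proj : continuousType cylinder A :=
  fst_map A I \o subspace_incl cylinder.

Definition cyl_time : continuousType cylinder I :=
  snd_map A I \o subspace_incl cylinder.

Lemma cyl_U (x : cylinder) : set_val (cyl_time x) <= 2 / 3 -> U (cyl_proj x).
Proof. by have [] := set_valP x. Qed.

Lemma cyl_V (x : cylinder) : 1 / 3 <= set_val (cyl_time x) -> V (cyl_proj x).
Proof. by have [] := set_valP x. Qed.

Lemma cyl_notW (x : cylinder) : ~ W (cyl_proj x) ->
  set_val (cyl_time x) < 1 / 3 \/ 2 / 3 < set_val (cyl_time x).
Proof.
move=> nW; case: (ltP (set_val (cyl_time x)) (1 / 3)) => [|h1]; first by left.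
right; rewrite ltNge; apply/negP => h2; apply: nW.
by split; [exact: cyl_U|exact: cyl_V].
Qed.

Lemma susp_map_top (w w' : W) : susp_map W (w, I1 RR) = susp_map W (w', I1 RR).
Proof. by apply/susp_mapP; apply: Or33. Qed.

Lemma susp_map_bot (w w' : W) : susp_map W (w, I0 RR) = susp_map W (w', I0 RR).
Proof. by apply/susp_mapP; apply: Or32. Qed.

Lemma cone_map_bot (w w' : W) : cone_map W (w, I0 RR) = cone_map W (w', I0 RR).
Proof. by apply/cone_mapP; right. Qed.

Lemma cyl_susp_continuous : continuous (fun x : cylinder =>
  @susp_map RR W (pick_point (cyl_proj x), clamp (cyl_time x))).
Proof.
apply: (@over_continuous _ _ cyl_proj (clamp \o cyl_time)) => x.
move=> /cyl_notW[x0|x1].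
  apply: filterS (near_itv_lt x0) => y y0; rewrite /= !clamp_eq0 ?ltW//.
  exact: susp_map_bot.
apply: filterS (near_itv_gt x1) => y y1; rewrite /= !clamp_eq1 ?ltW//.
exact: susp_map_top.
Qed.

Definition cyl_susp : continuousType cylinder (suspension RR W) :=
  mkcts cyl_susp_continuous.

Definition lower : set cylinder := [set x | set_val (cyl_time x) < 2 / 3].
Definition upper : set cylinder := [set x | 1 / 3 < set_val (cyl_time x)].
Local Notation middle := (lower `&` upper).

Lemma lower_open : open lower.
Proof.
by rewrite openE => x /near_itv_lt h.
Qed.

Lemma upper_open : open upper.
Proof.
by rewrite openE => x /near_itv_gt h.
Qed.

Lemma lower_upper : lower `|` upper = [set: cylinder].
Proof.
apply/seteqP; split=> // x _; rewrite /lower /upper /=.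
by case: (ltP (set_val (cyl_time x)) (2 / 3)) => h; [left|right; lra].
Qed.

Lemma lowerU x : lower x -> U (cyl_proj x).
Proof. by move=> /ltW; exact: cyl_U. Qed.

Lemma upperV x : upper x -> V (cyl_proj x).
Proof. by move=> /ltW; exact: cyl_V. Qed.

(** The base of the cone is not collapsed, but a point of [lower] outside W has time below 1/3 and
    so goes to the apex. *)
Lemma lower_cone_continuous : continuous (fun x : lower =>
  @cone_map RR W (pick_point (cyl_proj (set_val x)),
    clamp (cyl_time (set_val x)))).
Proof.
apply: (@over_continuous lower (cone RR W) (cyl_proj \o subspace_incl lower)
  (clamp \o (cyl_time \o subspace_incl lower))) => x /cyl_notW[x0|x1];
  last first.
  have : set_val (cyl_time (set_val x)) < 2 / 3 := set_valP x.
  by move: x1 => /= *; lra.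
have := @near_itv_lt _ (cyl_time \o subspace_incl lower) x _ x0.
apply: filterS => y /= y0; rewrite !clamp_eq0 ?ltW//.
exact: cone_map_bot.
Qed.

Definition lower_cone : continuousType lower (cone RR W) :=
  mkcts lower_cone_continuous.

Lemma upper_homotopy_continuous : continuous (fun x : upper * I =>
  @susp_map RR W (pick_point (cyl_proj (set_val x.1)),
    itv_max (clamp (cyl_time (set_val x.1)), x.2))).
Proof.
apply: (@over_continuous (upper * I)%type (suspension RR W)
  (cyl_proj \o (subspace_incl upper \o fst_map upper I))
  (itv_max \o pair_map
     (clamp \o (cyl_time \o (subspace_incl upper \o fst_map upper I)))
     (snd_map upper I))) => x /cyl_notW[x0|x1].
  have x1 : 1 / 3 < set_val (cyl_time (set_val x.1)) := set_valP x.1.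
  by have := lt_trans x1 x0; rewrite ltxx.
have top (y : upper * I) : 2 / 3 < set_val (cyl_time (set_val y.1)) ->
    itv_max (clamp (cyl_time (set_val y.1)), y.2) = I1 RR.
  by move=> y1; rewrite clamp_eq1 ?itv_max1l// ltW.
have := @near_itv_gt _
  (cyl_time \o (subspace_incl upper \o fst_map upper I)) x _ x1.
apply: filterS => y y1.
pose f (z : upper * I) := susp_map W (pick_point (cyl_proj (set_val z.1)),
  itv_max (clamp (cyl_time (set_val z.1)), z.2)).
have E : f y = f x by rewrite /f (top y y1) (top x x1); exact: susp_map_top.
exact: E.
Qed.

(** Contracts [cyl_susp] on [upper] to the base point. Outside W the time exceeds 2/3, so the height
    is constantly 1 there. *)
Definition upper_homotopy : continuousType (upper * I)%type (suspension RR W) :=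
  mkcts upper_homotopy_continuous.

Definition middle_proj : continuousType middle W :=
  corestrict (U := W) (f := cyl_proj \o subspace_incl middle)
    (fun x => let: conj l u := set_valP x in conj (lowerU l) (upperV u)).

(** A lift of the contraction to the cone, where it ends on the base, a copy of W, and not at a
    point. This is how the class on W enters the comparison. *)
Definition middle_homotopy : continuousType (middle * I)%type (cone RR W) :=
  cone_map W \o pair_map (middle_proj \o fst_map middle I)
    (itv_max \o pair_map
       (clamp \o (cyl_time \o (subspace_incl middle \o fst_map middle I)))
       (snd_map middle I)).

End DoubleMappingCylinder.

(** * Pulling suspended classes back to the cylinder *)

Section SuspensionIsomorphism.
Context {RR : realType} {G : zmodType} {A : topologicalType}.
Local Notation I := (unit_interval RR).
Local Notation cochain X := (cochain RR X G).
Variables (U V : set A).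
Hypotheses (oU : open U) (oV : open V).
Local Notation W := (U `&` V).
Variable z0 : W.
Local Notation M := (@cylinder RR A U V).
Local Notation cyl_proj := (@cyl_proj RR A U V).
Local Notation cyl_time := (@cyl_time RR A U V).
Local Notation lower := (@lower RR A U V).
Local Notation upper := (@upper RR A U V).
Local Notation middle := (lower `&` upper).
Local Notation p := (@cyl_susp RR A U V oU oV z0).
Local Notation G0 := (@upper_homotopy RR A U V oU oV z0).
Local Notation G1 := (@middle_homotopy RR A U V).
Local Notation i_middle_upper :=
  (@subset_incl M middle upper (@subIsetr _ lower upper)).
Local Notation i_middle_lower :=
  (@subset_incl M middle lower (@subIsetl _ lower upper)).

Lemma lower_coneE x :
  cone_to_suspension RR W (@lower_cone RR A U V oU oV z0 x) = p (set_val x).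
Proof. by []. Qed.

Lemma upper_homotopy0 x : G0 (x, I0 RR) = p (set_val x).
Proof. by congr (susp_map _ (_, _)); exact: itv_max0. Qed.

Lemma upper_homotopy1 x : G0 (x, I1 RR) = suspension_pt RR z0.
Proof.
rewrite -[RHS]/(susp_map W (z0, I1 RR)).
rewrite -[LHS]/(susp_map W (pick_point z0 (cyl_proj (set_val x)),
  itv_max (clamp (cyl_time (set_val x)), I1 RR))).
by rewrite itv_max1r; exact: susp_map_top.
Qed.

Lemma middle_projE x : set_val (@middle_proj RR A U V x) = cyl_proj (set_val x).
Proof. by []. Qed.

Lemma pick_middle (x : middle) :
  pick_point z0 (cyl_proj (set_val x)) = @middle_proj RR A U V x.
Proof. by rewrite -middle_projE pick_point_val. Qed.

Lemma middle_homotopyE x :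
  cone_to_suspension RR W (G1 x) = restrict_homotopy i_middle_upper G0 x.
Proof.
case: x => x r; congr (susp_map _ (_, _)).
by rewrite -[LHS]/(@middle_proj RR A U V x) -pick_middle.
Qed.

Lemma middle_homotopy0 x :
  G1 (x, I0 RR) = @lower_cone RR A U V oU oV z0 (i_middle_lower x).
Proof.
rewrite -[LHS]/(cone_map W (@middle_proj RR A U V x,
  itv_max (clamp (cyl_time (set_val x)), I0 RR))).
by rewrite itv_max0 -pick_middle.
Qed.

Lemma middle_homotopy1 x :
  G1 (x, I1 RR) = cone_base RR W (@middle_proj RR A U V x).
Proof.
rewrite -[LHS]/(cone_map W (@middle_proj RR A U V x,
  itv_max (clamp (cyl_time (set_val x)), I1 RR))).
by rewrite itv_max1r.
Qed.

Lemma pull_point (X Y : topologicalType) (f : continuousType X Y) (y : Y) m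
    (c : cochain Y m) :
  pull_cochain (subspace_incl [set y]) c = 0 -> (forall x, f x = y) ->
  pull_cochain f c = 0.
Proof.
move=> c0 fy; pose g := corestrict (U := [set y]) (f := f) fy.
have -> : pull_cochain f c =
    pull_cochain g (pull_cochain (subspace_incl [set y]) c).
  by rewrite pull_cochain_comp; apply: eq_pull_cochain.
by rewrite c0.
Qed.

Lemma prism0 (X Y : topologicalType) (H : continuousType (X * I)%type Y) m :
  prism H (0 : cochain Y m.+1) = 0.
Proof.
apply/funext => s; rewrite /prism /prism_homotopy.
have h : prism_sharp H s (0 : cochain Y m.+1) = 0 - 0 by rewrite subrr.
by rewrite h cone_homotopyB// subrr.
Qed.

(* Injectivity of the suspension homomorphism, as seen on the cylinder. *)
Lemma pull_susp_coboundary m (alpha : cochain W m)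
    (gamma : cochain (cone RR W) m) (beta : cochain (suspension RR W) m.+1) :
  coboundary_prop alpha -> coboundary beta = 0 ->
  pull_cochain (subspace_incl [set suspension_pt RR z0]) beta = 0 ->
  pull_cochain (cone_base RR W) gamma = alpha ->
  coboundary gamma = pull_cochain (cone_to_suspension RR W) beta ->
  exists b, pull_cochain p beta = coboundary b.
Proof.
move=> alpha0 dbeta beta_pt gamma_alpha dgamma.
(* Two primitives of the pullback of [beta]: on [lower] the map lifts to the cone, where [gamma] is
   one; on [upper] it contracts to the base point, where [beta] vanishes. *)
pose y := pull_cochain (@lower_cone RR A U V oU oV z0) gamma.
pose z := - prism G0 beta.
apply: (@glue_coboundary RR G _ lower upper m _ (extend y) (extend z)).
- exact: lower_open.
- exact: upper_open.
- exact: lower_upper.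
- by rewrite pull_coboundary dbeta.
- apply/pull_eq; rewrite -pull_coboundary extend_pull pull_coboundary dgamma.
  rewrite !pull_cochain_comp; apply: eq_pull_cochain => x.
  by rewrite /= -lower_coneE.
- apply/pull_eq; rewrite -pull_coboundary extend_pull coboundaryN.
  have := prism_coboundary G0 beta.
  rewrite dbeta prism0.
  rewrite (pull_point beta_pt) ?sub0r; last by move=> x; exact: upper_homotopy1.
  move=> /esym/eqP; rewrite subr_eq0 => /eqP <-; rewrite opprK.
  rewrite pull_cochain_comp; apply: eq_pull_cochain => x.
  by rewrite at_timeE upper_homotopy0.
have -> : pull_cochain (subspace_incl middle) (extend y - extend z) =
    pull_cochain i_middle_lower y - pull_cochain i_middle_upper z.
  rewrite -[in RHS](extend_pull y) -[in RHS](extend_pull z).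
  rewrite !pull_cochain_comp pull_cochainB.
  by congr (_ - _); apply: eq_pull_cochain.
(* The homotopy on the cone shows that the two primitives differ over the middle by the pullback of
   [alpha], up to a coboundary. *)
have := prism_homotopic G1 gamma.
rewrite dgamma -prism_comp.
have -> : prism (cone_to_suspension RR W \o G1) beta =
    pull_cochain i_middle_upper (prism G0 beta).
  rewrite -prism_restrict; apply: (congr1 (fun H => prism H beta)).
  apply/continuousEP => x.
  exact: middle_homotopyE.
have -> : pull_cochain (at_time G1 (I0 RR)) gamma =
    pull_cochain i_middle_lower y.
  rewrite /y pull_cochain_comp; apply: eq_pull_cochain => x.
  exact: middle_homotopy0.
have -> : pull_cochain (at_time G1 (I1 RR)) gamma =
    pull_cochain (@middle_proj RR A U V) alpha.
  rewrite -gamma_alpha pull_cochain_comp; apply: eq_pull_cochain => x.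
  exact: middle_homotopy1.
move=> h.
have := coboundary_propB
  (coboundary_prop_pull (@middle_proj RR A U V) alpha0) h.
rewrite -[pull_cochain i_middle_upper z]/(-
  pull_cochain i_middle_upper (prism G0 beta)).
by rewrite -[_ - _ - pull_cochain i_middle_upper _]addrA -opprD subKr opprK.
Qed.

End SuspensionIsomorphism.

(** * Injectivity of the projection from the cylinder in cohomology *)

Section CylinderProjection.
Context {RR : realType} {G : zmodType} {A : topologicalType}.
Local Notation I := (unit_interval RR).
Local Notation cochain X := (cochain RR X G).
Variables (U V : set A).
Hypotheses (oU : open U) (oV : open V) (UV : U `|` V = [set: A]).
Local Notation W := (U `&` V).
Local Notation M := (@cylinder RR A U V).
Local Notation cyl_proj := (@cyl_proj RR A U V).

Lemma cyl_bottom_subproof (x : U) : M (set_val x, I0 RR).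
Proof.
split=> /= h; first exact: set_valP.
by move: h; rewrite set_val_I0 => h; lra.
Qed.

Lemma cyl_top_subproof (x : V) : M (set_val x, I1 RR).
Proof.
split=> /= h; last exact: set_valP.
by move: h; rewrite set_val_I1 => h; lra.
Qed.

Definition cyl_bottom : continuousType U M :=
  corestrict (U := M) (f := pair_map (subspace_incl U) (cst (I0 RR)))
    cyl_bottom_subproof.

Definition cyl_top : continuousType V M :=
  corestrict (U := M) (f := pair_map (subspace_incl V) (cst (I1 RR)))
    cyl_top_subproof.

Lemma cyl_middle_subproof (x : W * I) : M (set_val x.1, x.2).
Proof. by have [] := set_valP x.1; split. Qed.

Definition cyl_middle : continuousType (W * I)%type M :=
  corestrict (U := M)
    (f := pair_map (subspace_incl W \o fst_map W I) (snd_map W I))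
    cyl_middle_subproof.

(** Restricting [zeta] to the bottom copy of [U] and the top copy of [V] gives primitives of [x];
    over the intersection the vertical homotopy [cyl_middle] joins them. *)
Lemma cyl_proj_coboundary m (x : cochain A m.+1) (zeta : cochain M m) :
  coboundary x = 0 -> pull_cochain cyl_proj x = coboundary zeta ->
  exists b, x = coboundary b.
Proof.
move=> dx xzeta.
pose y := pull_cochain cyl_bottom zeta; pose z := pull_cochain cyl_top zeta.
have xy : pull_cochain (subspace_incl U) x = coboundary y.
  rewrite /y pull_coboundary -xzeta pull_cochain_comp.
  exact: eq_pull_cochain.
apply: (@glue_coboundary RR G _ U V m _ (extend y) (extend z)) => //.
- by apply/pull_eq; rewrite -pull_coboundary extend_pull.
- apply/pull_eq; rewrite -pull_coboundary extend_pull pull_coboundary -xzeta.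
  by rewrite pull_cochain_comp; exact: eq_pull_cochain.
pose iU := @subset_incl A W U (@subIsetl _ U V).
pose iV := @subset_incl A W V (@subIsetr _ U V).
have -> : pull_cochain (subspace_incl W) (extend y - extend z) =
    pull_cochain iU y - pull_cochain iV z.
  rewrite -[in RHS](extend_pull y) -[in RHS](extend_pull z).
  rewrite !pull_cochain_comp pull_cochainB.
  by congr (_ - _); apply: eq_pull_cochain.
have h1 := prism_homotopic cyl_middle zeta.
(* The coboundary of [zeta] comes from A, so its prism term is that of the constant homotopy, which
   is a coboundary. *)
have h2 := prism_homotopic (fst_map W I) (pull_cochain iU y).
have e1 : prism cyl_middle (coboundary zeta) =
    prism (fst_map W I) (coboundary (pull_cochain iU y)).
  rewrite pull_coboundary -xy -xzeta pull_cochain_comp -!prism_comp.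
  by apply: (congr1 (fun H => prism H x)); apply/continuousEP.
have e2 (r : I) : pull_cochain (at_time (fst_map W I) r) (pull_cochain iU y) =
    pull_cochain iU y.
  by rewrite pull_cochain_comp; exact: eq_pull_cochain.
rewrite !e2 subrr sub0r in h2; rewrite e1 in h1.
have := coboundary_propN (coboundary_propB h1 h2).
rewrite opprK subrK opprB.
have -> : pull_cochain (at_time cyl_middle (I0 RR)) zeta = pull_cochain iU y.
  by rewrite /y pull_cochain_comp; apply: eq_pull_cochain => w; exact/val_inj.
have -> : pull_cochain (at_time cyl_middle (I1 RR)) zeta = pull_cochain iV z.
  by rewrite /z pull_cochain_comp; apply: eq_pull_cochain => w; exact/val_inj.
by [].
Qed.

End CylinderProjection.

(** * Open covers of the suspension and of the cone *)

Section SuspensionClass.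
Context {RR : realType} {A : topologicalType}.
Variables (U V : set A).
Local Notation W := (U `&` V).
Local Notation C := (cone RR W).
Local Notation S := (suspension RR W).
Local Notation pi := (cone_to_suspension RR W).

Definition susp_height : S -> RR := height (@susp_map_surj RR W).

Lemma susp_heightE x : susp_height (susp_map W x) = set_val x.2.
Proof. by apply: heightE; exact: susp_map_inj. Qed.

Definition susp_shadow : S -> W := shadow (@susp_map_surj RR W).

Lemma susp_shadowE x :
  0 < set_val x.2 < 1 -> susp_shadow (susp_map W x) = x.1.
Proof.
by apply: (@shadowE RR W S (susp_map W) _ (@susp_good RR)); exact: susp_map_inj.
Qed.

Definition cone_shadow : C -> W := shadow (@cone_map_surj RR W).

Lemma cone_shadowE x :
  0 < set_val x.2 -> cone_shadow (cone_map W x) = x.1.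
Proof.
by apply: (@shadowE RR W C (cone_map W) _ (@cone_good RR)); exact: cone_map_inj.
Qed.

Unset Implicit Arguments.
Lemma susp_height_continuous : continuous susp_height.
Proof.
apply: height_continuous; first exact: susp_map_quotient.
exact: susp_map_inj.
Qed.
Set Implicit Arguments.

(** Omits only the base point, at height 1; [susp_upper] omits only the image of the apex. *)
Definition susp_lower : set S := [set y | susp_height y < 1].
Definition susp_upper : set S := [set y | 0 < susp_height y].
Local Notation susp_middle := (susp_lower `&` susp_upper).

Unset Implicit Arguments.
Lemma susp_lower_open : open susp_lower.
Proof.
apply: (@open_comp S RR susp_height [set x | x < 1]); last exact: open_lt.
by move=> y _; exact: susp_height_continuous.
Qed.

Lemma susp_upper_open : open susp_upper.
Proof.
apply: (@open_comp S RR susp_height [set x | 0 < x]); last exact: open_gt.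
by move=> y _; exact: susp_height_continuous.
Qed.

Lemma susp_lower_upper : susp_lower `|` susp_upper = [set: S].
Proof.
apply/seteqP; split=> // y _; rewrite /susp_lower /susp_upper /=.
by case: (ltP (susp_height y) 1) => h; [left|right; exact: lt_le_trans h].
Qed.

Lemma susp_shadow_continuous :
  continuous (susp_shadow \o subspace_incl susp_middle).
Proof.
have good (y : susp_middle) :
    susp_good (height (@susp_map_surj RR W) (subspace_incl susp_middle y)).
  by have [l u] := set_valP y; apply/andP.
exact (@shadow_continuous RR W S (susp_map W) (@susp_map_quotient RR W)
  (@susp_map_surj RR W) _ (@susp_good_open RR) (@susp_map_inj RR W) _ _ good).
Qed.

Definition susp_middle_proj : continuousType susp_middle W :=
  mkcts susp_shadow_continuous.

Definition cone_lower : set C := pi @^-1` susp_lower.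
Definition cone_upper : set C := pi @^-1` susp_upper.

Lemma cone_lower_open : open cone_lower.
Proof.
by apply: open_comp => [x _|]; [exact: cts_fun|exact: susp_lower_open].
Qed.

Lemma cone_upper_open : open cone_upper.
Proof.
by apply: open_comp => [x _|]; [exact: cts_fun|exact: susp_upper_open].
Qed.

Lemma cone_lower_upper : cone_lower `|` cone_upper = [set: C].
Proof.
apply/seteqP; split=> // x _.
by have : (susp_lower `|` susp_upper) (pi x) by rewrite susp_lower_upper.
Qed.

Lemma cone_shadow_continuous :
  continuous (cone_shadow \o subspace_incl cone_upper).
Proof.
have good (y : cone_upper) :
    cone_good (height (@cone_map_surj RR W) (subspace_incl cone_upper y)).
  have [x xy] := cone_map_surj (set_val y).
  have : 0 < susp_height (pi (set_val y)) := set_valP y.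
  rewrite -xy -[pi _]/(susp_map W x) susp_heightE.
  rewrite -[subspace_incl _ y]/(set_val y) -xy.
  by rewrite (heightE _ (@cone_map_inj RR W)).
exact (@shadow_continuous RR W C (cone_map W) (@cone_map_quotient RR W)
  (@cone_map_surj RR W) _ (@cone_good_open RR) (@cone_map_inj RR W) _ _ good).
Qed.
Set Implicit Arguments.

Definition cone_upper_proj : continuousType cone_upper W :=
  mkcts cone_shadow_continuous.

End SuspensionClass.

(** * The Mayer-Vietoris coboundary as a suspension *)

Section SuspensionExistence.
Context {RR : realType} {G : zmodType} {A : topologicalType}.
Local Notation cochain X := (cochain RR X G).
Variables (U V : set A).
Hypotheses (oU : open U) (oV : open V).
Local Notation W := (U `&` V).
Variable z0 : W.
Local Notation cyl_proj := (@cyl_proj RR A U V).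
Local Notation cyl_time := (@cyl_time RR A U V).
Local Notation lower := (@lower RR A U V).
Local Notation upper := (@upper RR A U V).
Local Notation p := (@cyl_susp RR A U V oU oV z0).
Local Notation C := (cone RR W).
Local Notation S := (suspension RR W).
Local Notation pi := (cone_to_suspension RR W).
Local Notation susp_lower := (@susp_lower RR A U V).
Local Notation susp_upper := (@susp_upper RR A U V).
Local Notation susp_middle := (susp_lower `&` susp_upper).
Local Notation cone_lower := (@cone_lower RR A U V).
Local Notation cone_upper := (@cone_upper RR A U V).
Local Notation susp_middle_proj := (@susp_middle_proj RR A U V).
Local Notation cone_upper_proj := (@cone_upper_proj RR A U V).

Lemma cyl_suspE x :
  p x = susp_map W (pick_point z0 (cyl_proj x), clamp (cyl_time x)).
Proof. by []. Qed.

Lemma susp_lower_cyl x : lower x -> susp_lower (p x).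
Proof.
move=> h; rewrite -[susp_lower _]/(is_true (susp_height (p x) < 1)).
by rewrite cyl_suspE susp_heightE; exact: clamp_lt1.
Qed.

Lemma susp_upper_cyl x : upper x -> susp_upper (p x).
Proof.
move=> h; rewrite -[susp_upper _]/(is_true (0 < susp_height (p x))).
by rewrite cyl_suspE susp_heightE; exact: clamp_gt0.
Qed.

Lemma susp_shadow_cyl x : lower x -> upper x ->
  set_val (susp_shadow (p x)) = cyl_proj x.
Proof.
move=> l u; rewrite cyl_suspE susp_shadowE; last first.
  by apply/andP; split; [exact: clamp_gt0|exact: clamp_lt1].
by apply: pick_pointE; split; [exact: lowerU l|exact: upperV u].
Qed.

Lemma susp_upper_pt : susp_upper (suspension_pt RR z0).
Proof.
rewrite -[susp_upper _]/(is_true (0 < susp_height (susp_map W (z0, I1 RR)))).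
by rewrite susp_heightE set_val_I1 ltr01.
Qed.

Lemma cone_upper_base w : cone_upper (cone_base RR W w).
Proof.
rewrite -[cone_upper _]/(is_true (0 < susp_height (susp_map W (w, I1 RR)))).
by rewrite susp_heightE set_val_I1 ltr01.
Qed.

Lemma cone_shadow_base w : cone_shadow (cone_base RR W w) = w.
Proof. by rewrite cone_baseE cone_shadowE// set_val_I1 ltr01. Qed.

Lemma cone_shadow_susp x : cone_lower x -> cone_upper x ->
  cone_shadow x = susp_shadow (pi x).
Proof.
have [y <-] := cone_map_surj x.
rewrite -[cone_lower _]/(is_true (susp_height (susp_map W y) < 1)).
rewrite -[cone_upper _]/(is_true (0 < susp_height (susp_map W y))).
rewrite susp_heightE => l u; rewrite cone_shadowE//.
by rewrite -[pi _]/(susp_map W y) susp_shadowE// u.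
Qed.

(** Spread [c] over the suspension as [e]. Then [beta] is the coboundary of [e] below and 0 above,
    and on the cylinder [bU] minus the pullback of [e] glues with [bV]. The equalities hold on
    cochains, as [suspends_to] requires. *)
Lemma suspension_class m (alpha : cochain A m.+1) (bU bV : cochain A m) :
  coboundary alpha = 0 ->
  (forall s, inside U s -> alpha s = coboundary bU s) ->
  (forall s, inside V s -> alpha s = coboundary bV s) ->
  let c := pull_cochain (subspace_incl W) (bU - bV) in
  exists (gamma : cochain C m) (beta : cochain S m.+1),
    [/\ coboundary beta = 0,
        pull_cochain (subspace_incl [set suspension_pt RR z0]) beta = 0,
        pull_cochain (cone_base RR W) gamma = c,
        coboundary gamma = pull_cochain pi beta &
        exists d, pull_cochain cyl_proj alpha - pull_cochain p beta =
          coboundary d].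
Proof.
move=> dalpha alphaU alphaV c.
have dc : coboundary c = 0 by exact: coboundary_incl_sub alphaU alphaV.
pose e := extend (pull_cochain susp_middle_proj c).
have de s : inside susp_middle s -> coboundary e s = 0.
  move=> /insideP[s' ->]; rewrite coboundary_extend.
  by rewrite pull_coboundary dc.
(* [b] represents the Mayer-Vietoris coboundary of [c], but it is a cocycle on
   small simplices only; [beta] corrects it. *)
pose b := extend (pull_cochain (subspace_incl susp_lower) (coboundary e)).
have bl s : inside susp_lower s -> b s = coboundary e s.
  by move=> /insideP[s' ->]; rewrite /b extendE.
have bu s : inside susp_upper s -> b s = 0.
  move=> su; have [sl|nsl] := pselect (inside susp_lower s).
    by rewrite bl// de.
  by rewrite /b extend_out.
have db s : small susp_lower susp_upper s -> coboundary b s = 0.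
  case=> h.
    by rewrite (coboundary_inside bl)// coboundaryK.
  by rewrite (coboundary_inside (d := 0) bu)// coboundary0.
have [k dk k0] := small_simplices (susp_lower_open U V) (susp_upper_open U V)
  (susp_lower_upper U V) (coboundaryK b) db.
pose beta := b - k.
have dbeta : coboundary beta = 0 by rewrite coboundaryB dk subrr.
have betal s : inside susp_lower s -> beta s = coboundary e s.
  by move=> sl; rewrite -[beta s]/(b s - k s) bl// k0 ?subr0//; left.
have betau s : inside susp_upper s -> beta s = 0.
  by move=> su; rewrite -[beta s]/(b s - k s) bu// k0 ?subr0//; right.
(* On the cone [c] extends up to the base: [g] is the pullback of [e] below and a cocycle above, so
   its coboundary is the pullback of [beta] on small simplices. *)
pose g := extend (pull_cochain cone_upper_proj c).
have gl s : inside cone_lower s -> g s = pull_cochain pi e s.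
  move=> sl; have [su|nsu] := pselect (inside cone_upper s); last first.
    rewrite /pull_cochain /g /e !extend_out// => h.
    by apply: nsu => t; have [] := h t.
  have sm : inside susp_middle (pi \o s : singular_simplex RR S m).
    by move=> t; split; [exact: sl|exact: su].
  rewrite /pull_cochain.
  have [s1 s1E] := insideP sm; have [s2 s2E] := insideP su.
  rewrite [in RHS]s1E s2E /g /e !extendE; congr c.
  apply/continuousEP => t.
  rewrite -[LHS]/(cone_shadow (subspace_incl _ (s2 t))).
  rewrite -[RHS]/(susp_shadow (subspace_incl _ (s1 t))).
  have <- : pi (s t) = subspace_incl _ (s1 t).
    exact: (iffLR (continuousEP _ _) s1E t).
  have <- : s t = subspace_incl _ (s2 t).
    exact: (iffLR (continuousEP _ _) s2E t).
  exact: cone_shadow_susp.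
have dgu s : inside cone_upper s -> coboundary g s = 0.
  move=> /insideP[s' ->]; rewrite coboundary_extend.
  by rewrite pull_coboundary dc.
pose x := coboundary g - pull_cochain pi beta.
have dx : coboundary x = 0.
  by rewrite coboundaryB coboundaryK pull_coboundary dbeta subrr.
have x0 s : small cone_lower cone_upper s -> x s = 0.
  rewrite -[x s]/(coboundary g s - beta (pi \o s)); case=> h.
    rewrite betal// (coboundary_inside gl h) pull_coboundary.
    exact: subrr.
  by rewrite betau// dgu// subrr.
have [k' dk' k'0] := small_simplices (cone_lower_open U V)
  (cone_upper_open U V) (cone_lower_upper U V) dx x0.
exists (g - k'), beta; split => //.
- apply/funext => s; apply: betau => t.
  have h : set_val (s t) = suspension_pt RR z0 := set_valP (s t).
  exact: (@eq_ind_r _ _ susp_upper susp_upper_pt _ h).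
(* Simplices of the base lie in [cone_upper], where [k'] vanishes, so the correction keeps the
   restriction equal to [c]. *)
- apply/funext => s.
  have su : inside cone_upper (cone_base RR W \o s : singular_simplex RR C m).
    by move=> t; exact: cone_upper_base.
  rewrite -[LHS]/(g (cone_base RR W \o s) - k' (cone_base RR W \o s)).
  rewrite k'0 ?subr0; last by right.
  have [s' s'E] := insideP su; rewrite s'E /g extendE; congr c.
  apply/continuousEP => t.
  rewrite -[LHS]/(cone_shadow (subspace_incl _ (s' t))).
  have <- : cone_base RR W (s t) = subspace_incl _ (s' t).
    exact: (iffLR (continuousEP _ _) s'E t).
  exact: cone_shadow_base.
- by rewrite coboundaryB dk' subKr.
apply: (@glue_coboundary RR G _ lower upper m _
  (pull_cochain cyl_proj bU - pull_cochain p e) (pull_cochain cyl_proj bV)).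
- exact: lower_open.
- exact: upper_open.
- exact: lower_upper.
- by rewrite coboundaryB !pull_coboundary dalpha dbeta subrr.
- move=> s sl; rewrite coboundaryB !pull_coboundary.
  rewrite -[LHS]/(alpha (cyl_proj \o s) - beta (p \o s)).
  rewrite alphaU; last by move=> t; exact: lowerU.
  by rewrite betal// => t; exact: susp_lower_cyl.
- move=> s su; rewrite pull_coboundary.
  rewrite -[LHS]/(alpha (cyl_proj \o s) - beta (p \o s)).
  rewrite alphaV; last by move=> t; exact: upperV.
  by rewrite betau ?subr0// => t; exact: susp_upper_cyl.
(* Over the middle [e] pulls back to [bU - bV], so the two primitives are equal there. *)
suff -> : pull_cochain (subspace_incl (lower `&` upper))
    (pull_cochain cyl_proj bU - pull_cochain p e -
     pull_cochain cyl_proj bV) = 0.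
  by case: (m) => //= l; exists 0; rewrite coboundary0.
apply/funext => s; have sm := inside_incl s.
set s1 := subspace_incl _ \o s in sm *.
rewrite -[LHS]/(bU (cyl_proj \o s1) - e (p \o s1) - bV (cyl_proj \o s1)).
have pm : inside susp_middle (p \o s1 : singular_simplex RR S m).
  move=> t; have [l u] := sm t.
  by split; [exact: susp_lower_cyl|exact: susp_upper_cyl].
have [s2 s2E] := insideP pm; rewrite s2E /e extendE.
pose s3 : singular_simplex RR A m :=
  subspace_incl W \o (susp_middle_proj \o s2).
rewrite -[pull_cochain _ _ _]/(bU s3 - bV s3).
have -> : s3 = cyl_proj \o s1.
  apply/continuousEP => t.
  rewrite -[LHS]/(set_val (susp_shadow (subspace_incl _ (s2 t)))).
  have <- : p (s1 t) = subspace_incl _ (s2 t).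
    exact: (iffLR (continuousEP _ _) s2E t).
  by have [l u] := sm t; rewrite susp_shadow_cyl.
by rewrite subKr subrr.
Qed.

End SuspensionExistence.

(** * Vanishing of the operation *)

Section CohomologyClasses.
Context {RR : realType} {G : zmodType}.
Local Notation H X m := (cohomology RR X G m).
Implicit Types X Y Z : topologicalType.

Lemma cclass_eq X m (z w : cocycle RR X G m) :
  cclass z = cclass w <->
  coboundary_prop ((z : cochain RR X G m) - (w : cochain RR X G m)).
Proof.
split=> [zw|zw].
  have : z - w \in @is_coboundary RR X G m.
    by rewrite Quotient.idealrBE; apply/eqP.
  by move=> /asboolP.
apply/eqP; rewrite /cclass -Quotient.idealrBE; exact/asboolP.
Qed.

Lemma cclass0 X m : cclass (0 : cocycle RR X G m) = 0.
Proof. by have := cclassB (0 : cocycle RR X G m) 0; rewrite !subrr. Qed.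

Lemma cclass_eq0 X m (z : cocycle RR X G m) :
  cclass z = 0 <-> coboundary_prop (z : cochain RR X G m).
Proof. by rewrite -cclass0 cclass_eq subr0. Qed.

Lemma pullback0 X Y (f : continuousType X Y) m : pullback f (0 : H Y m) = 0.
Proof. by have := pullbackB f (0 : H Y m) 0; rewrite !subrr. Qed.

Lemma pullback_comp X Y Z (f : continuousType X Y) (g : continuousType Y Z) m
    (x : H Z m) :
  pullback f (pullback g x) = pullback (g \o f) x.
Proof.
rewrite -[x]cclassK !pullbackE; congr cclass; apply: val_inj.
exact: pull_cochain_comp.
Qed.

Lemma eq_pullback X Y (f g : continuousType X Y) m (x : H Y m) :
  f =1 g -> pullback f x = pullback g x.
Proof. by move=> /continuousEP ->. Qed.

Lemma cocycle_coboundary X m (z : cocycle RR X G m) :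
  coboundary (z : cochain RR X G m) = 0.
Proof. by have /asboolP := cocycleP z. Qed.

Lemma mem_cocycle X m (c : cochain RR X G m) :
  coboundary c = 0 -> c \in @is_cocycle RR X G m.
Proof. by move=> dc; apply/asboolP. Qed.

Lemma pullback_incl_eq0 X (U : set X) m (z : cocycle RR X G m.+1) :
  pullback (subspace_incl U) (cclass z) = 0 ->
  exists b : cochain RR X G m, forall s, inside U s ->
    (z : cochain RR X G m.+1) s = coboundary b s.
Proof.
rewrite pullbackE => /cclass_eq0[b zb]; exists (extend b).
by apply/pull_eq; rewrite -pull_coboundary extend_pull -zb.
Qed.

(** The empty space satisfies [path_connected], so it is among the test spaces of the weight. *)
Lemma cohomology_empty X m (x : H X m) : (X -> False) -> x = 0.
Proof.
move=> X0; rewrite -[x]cclassK; apply/cclass_eq0.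
have c0 (c : cochain RR X G m) : c = 0.
  by apply/funext => s; case: (X0 (s (@vertex RR m ord0))).
case: m x c0 => [|m] x c0 /=; first exact: c0.
by exists 0; rewrite coboundary0.
Qed.

End CohomologyClasses.

Section Operation.
Context {RR : realType} {R S : zmodType} {i : int}.
Variable theta : cohomology_operation RR R S i.
Hypothesis theta_stable : stable theta.
Context {A : topologicalType}.
Variables (U V : set A).
Hypotheses (oU : open U) (oV : open V) (UV : U `|` V = [set: A]).
Variables (m : nat) (w : cohomology RR A R m.+1).
Hypotheses (wU : pullback (subspace_incl U) w = 0).
Hypotheses (wV : pullback (subspace_incl V) w = 0).

(** A class of degree 0 is zero once its restriction to each point is. Every point lies in [U] or
    [V], so [w] is reduced there, and theta preserves reduced classes. *)
Lemma operation_eq0_degree0 (e : m.+1%:Z + i = 0%:Z) : theta A m.+1 0 e w = 0.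
Proof.
have red a : reduced a w.
  rewrite /reduced.
  have restr0 (B : set A) : B a -> pullback (subspace_incl B) w = 0 ->
      pullback (subspace_incl [set a]) w = 0.
    move=> Ba wB; have aB : [set a] `<=` B by move=> _ ->.
    rewrite (_ : pullback _ w =
      pullback (subset_incl aB) (pullback (subspace_incl B) w)).
      by rewrite wB pullback0.
    by rewrite pullback_comp; apply: eq_pullback.
  have : (U `|` V) a by rewrite UV.
  by move=> [Ua|Va]; [exact: (restr0 U)|exact: (restr0 V)].
have := fun a => theta_stable.1 A a m.+1 0 e w (red a).
move: (theta A m.+1 0 e w) => x; rewrite -[x]cclassK; move: (repr x) => z zred.
apply/cclass_eq0 => /=; apply/funext => s.
pose a := s (vertex ord0).
have sa : inside [set a] s.
  move=> t; congr (s _); apply: simplex_eqP => j.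
  by rewrite /= mxE !ord1 -(simplex_sum1 t) big_ord1.
have := zred a; rewrite /reduced pullbackE => /cclass_eq0 /= z0.
have [s' ->] := insideP sa.
exact: (congr1 (fun c : cochain RR _ S 0 => c s') z0).
Qed.

Hypothesis theta_vanishes : vanishes_below theta m.+1.
Variable z0 : U `&` V.

Lemma operation_eq0 l (e : m.+1%:Z + i = l.+1%:Z) : theta A m.+1 l.+1 e w = 0.
Proof.
have e' : m%:Z + i = l%:Z.
  by apply: (addrI 1); rewrite addrA -!intS.
move: (wU) (wV); rewrite -[w]cclassK; move: (repr w) => alpha alphaU alphaV.
have [bU0 bU0E] := pullback_incl_eq0 alphaU.
have [bV bVE] := pullback_incl_eq0 alphaV.
pose c0 : cochain RR (U `&` V) R m :=
  pull_cochain (subspace_incl (U `&` V)) (bU0 - bV).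
have dc0 : coboundary c0 = 0 by exact: coboundary_incl_sub bU0E bVE.
(* Subtracting the pullback of [c0] along the constant map at [z0] keeps the coboundary, [c0] being
   a cocycle, and makes the difference on the intersection vanish at [z0]. *)
pose bU := bU0 - pull_cochain (cst z0) c0.
have bUE s : inside U s -> (alpha : cochain RR A R m.+1) s = coboundary bU s.
  by move=> sU; rewrite bU0E// coboundaryB pull_coboundary dc0 subr0.
have [gamma [beta [dbeta beta_pt gammaE dgamma [d dE]]]] :=
  suspension_class oU oV z0 (cocycle_coboundary alpha) bUE bVE.
set c := pull_cochain _ (bU - bV) in gammaE.
have dc : coboundary c = 0 by exact: coboundary_incl_sub bUE bVE.
pose a := cclass (Cocycle (mem_cocycle dc)).
pose b := cclass (Cocycle (mem_cocycle dbeta)).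
have c_pt : pull_cochain (subspace_incl [set z0]) c = 0.
  have -> : c = c0 - pull_cochain (cst z0 \o subspace_incl (U `&` V)) c0.
    apply/funext => s; set s' := subspace_incl (U `&` V) \o s.
    rewrite -[LHS]/(bU0 s' - pull_cochain (cst z0) c0 s' - bV s') addrAC.
    by congr (_ - _); congr c0; exact/continuousEP.
  rewrite pull_cochainB pull_cochain_comp.
  apply/eqP; rewrite subr_eq0; apply/eqP.
  by apply: eq_pull_cochain => y; exact: (set_valP y).
have a_red : reduced z0 a.
  rewrite /reduced pullbackE; apply/cclass_eq0 => /=; rewrite c_pt.
  by case: (m) => //= m'; exists 0; rewrite coboundary0.
have ab : suspends_to z0 a b.
  by exists (Cocycle (mem_cocycle dc)), gamma, (Cocycle (mem_cocycle dbeta)).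
have [alpha' [gamma' [beta' [alpha'E beta'E beta'_pt gamma'E dgamma']]]] :=
  theta_stable.2 _ z0 m l e' e a b a_red ab.
(* The class of [alpha'] is theta of a class of degree [m], just below the excess bound [m.+1]. *)
rewrite (theta_vanishes e' a (ltnSn m)) in alpha'E.
have [d' d'E] := pull_susp_coboundary oU oV (iffLR (cclass_eq0 _) alpha'E)
  (cocycle_coboundary beta') beta'_pt gamma'E dgamma'.
have theta_b :
    pullback (@cyl_susp RR A U V oU oV z0) (theta _ m.+1 l.+1 e b) = 0.
  by rewrite -beta'E pullbackE; apply/cclass_eq0; exists d'.
have wb : pullback (@cyl_proj RR A U V) (cclass alpha) =
    pullback (@cyl_susp RR A U V oU oV z0) b.
  by rewrite !pullbackE; apply/cclass_eq; exists d.
have : pullback (@cyl_proj RR A U V) (theta A m.+1 l.+1 e (cclass alpha)) = 0.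
  by rewrite -(operation_natural theta) wb (operation_natural theta).
move: (theta A m.+1 l.+1 e (cclass alpha)) => x; rewrite -[x]cclassK.
move: (repr x) => z; rewrite pullbackE => /cclass_eq0[zeta zE].
apply/cclass_eq0.
exact: (cyl_proj_coboundary oU oV UV (cocycle_coboundary z) zE).
Qed.

End Operation.

Section PathConnected.
Context {RR : realType} {A : topologicalType}.

(** If the sets were disjoint, a path from a point of [U] to one outside would split the interval
    into two nonempty open parts. *)
Lemma path_connected_cover (U V : set A) (a : A) :
  path_connected RR A -> open U -> open V -> U `|` V = [set: A] ->
  [\/ exists z, U z /\ V z, U = [set: A] | V = [set: A]].
Proof.
move=> A_pc oU oV UV.
have [?|noUV] := pselect (exists z, U z /\ V z); first exact: Or31.
have [?|nU] := pselect (U = [set: A]); first exact: Or32.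
apply: Or33; apply/seteqP; split=> // x _; apply: contrapT => nVx.
have Ux : U x by have : (U `|` V) x by [rewrite UV]; case.
have [y nUy] : exists y, ~ U y.
  apply: contrapT => h; apply: nU; apply/seteqP; split=> // y _.
  by apply: contrapT => nUy; apply: h; exists y.
have [p [px py]] := A_pc x y.
have [P oP PU] := open_preimage_val p oU.
have [Q oQ QV] := open_preimage_val p oV.
have PI : `[0, 1]%classic `&` P = `[0, 1]%classic.
  apply: (@segment_connected RR 0 1).
  - exists 0; split; first exact: unit_interval0.
    by apply/(PU (I0 RR)); rewrite px.
  - by exists P.
  exists (~` Q); first exact: open_closedC.
  apply/seteqP; split=> t [t01 h]; split=> //;
    pose t' : unit_interval RR := exist _ t (mem_set t01).
    by move=> /(QV t') Vt; apply: noUV; exists (p t'); split=> //; apply/PU.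
  apply/(PU t'); have : (U `|` V) (p t') by rewrite UV.
  by case=> // /QV.
have : (`[0, 1]%classic `&` P) 1 by rewrite PI; exact: unit_interval1.
by move=> [_ /(PU (I1 RR))]; rewrite py.
Qed.

End PathConnected.

Section Weight.
Context {RR : realType} {R S : zmodType} {X Y : topologicalType}.
Variables (f g : continuousType X Y).

Lemma cohom_distance_le1 (A : topologicalType) (p q : continuousType A Y) :
  (cohom_distance RR R p q <= 1%:E)%E ->
  exists U V : set A, [/\ open U, open V, U `|` V = [set: A],
    forall m (y : cohomology RR Y R m),
      pullback (p \o subspace_incl U) y = pullback (q \o subspace_incl U) y &
    forall m (y : cohomology RR Y R m),
      pullback (p \o subspace_incl V) y = pullback (q \o subspace_incl V) y].
Proof.
rewrite /cohom_distance; case: xgetP => [_ -> [n [[U [oU UT Upq]] _] <-]|_ //].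
rewrite lee_fin lez_nat => n1.
have UTj (x : A) : exists j, U j x.
  by have : (\bigcup_j U j) x by [rewrite UT]; case=> j; exists j.
(* At distance 0 the single member of the cover is used twice. *)
case: n n1 U oU UT Upq UTj => [|[|//]] _ U oU UT Upq UTj.
  exists (U ord0), (U ord0); split=> //.
  by apply/seteqP; split=> // x _; have [j] := UTj x; rewrite ord1; left.
exists (U ord0), (U ord_max); split=> //.
apply/seteqP; split=> // x _; have [j] := UTj x.
case: (unliftP ord0 j) => [j' ->|->]; last by left.
by rewrite ord1 (_ : lift ord0 ord0 = ord_max); [right|exact/val_inj].
Qed.

Lemma cohom_weight_ge2 (v : total_cohomology RR X S) :
  weight_bound R f g v 1 -> (2%:E <= cohom_weight R f g v)%E.
Proof.
move=> v1; rewrite /cohom_weight; case: asboolP => _; first exact: leey.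
case: xgetP => [_ -> [k [_ kmax] <-]|_]; last exact: leey.
by rewrite lee_fin -[2]/(1 + 1) lerD2r; exact: kmax.
Qed.

Lemma vanishes_below_excess i (theta : cohomology_operation RR R S i) n :
  (0 < n)%N -> ((n%:Z)%:E <= excess theta)%E -> vanishes_below theta n.
Proof.
move=> n0; rewrite /excess; case: asboolP => [//|_].
(* The default value 0 of the excess contradicts [0 < n]. *)
case: xgetP => [_ -> [n' [_ n'v _] <-]|_]; last first.
  by rewrite lee_fin lez_nat leqNgt n0.
rewrite lee_fin lez_nat => nn' Z m k e u mn; apply: n'v.
exact: leq_trans nn'.
Qed.

End Weight.

Theorem theorem2p6 (RR : realType) (R S : comPzRingType)
    (X Y : topologicalType)
    (X_pc : path_connected RR X) (X_ANR : ANR RR X)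
    (Y_pc : path_connected RR Y) (Y_ANR : ANR RR Y)
    (f g : continuousType X Y)
    (i : int) (theta : cohomology_operation RR R S i)
    (theta_stable : stable theta)
    (n : nat) (n_gt0 : (0 < n)%N)
    (theta_excess : ((n%:Z)%:E <= excess theta)%E)
    (k : nat) (degE : n%:Z + i = k%:Z)
    (u : cohomology RR X R n)
    (u_J : J_image f g (in_degree u)) :
  (2%:E <= cohom_weight R f g (in_degree (theta X n k degE u)))%E.
Proof.
apply: cohom_weight_ge2 => A phi A_pc.
move=> /cohom_distance_le1[U [V [oU oV UV Ufg Vfg]]] m.
have [->|mk] := eqVneq m k; last by rewrite in_degree_neq 1?eq_sym// pullback0.
rewrite in_degreeE -(operation_natural theta).
have [a|A0] := pselect (exists a : A, True); last first.
  by apply: cohomology_empty => a; apply: A0; exists a.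
have {}a := sval (cid a).
have [y /(_ n)] := u_J; rewrite in_degreeE => uE.
pose w : cohomology RR A R n := pullback phi u.
have w0 (B : set A) : (forall m (y : cohomology RR Y R m),
      pullback ((f \o phi) \o subspace_incl B) y =
      pullback ((g \o phi) \o subspace_incl B) y) ->
    pullback (subspace_incl B) w = 0.
  move=> Bfg; rewrite /w pullback_comp uE pullbackB !pullback_comp.
  apply/eqP; rewrite subr_eq0; apply/eqP.
  transitivity (pullback ((f \o phi) \o subspace_incl B) (y n)).
    exact: eq_pullback.
  by rewrite Bfg; exact: eq_pullback.
(* Stated for any cover with a common point, so that a member equal to A can be paired with
   itself. *)
have main (B C : set A) (z : A) : open B -> open C -> B `|` C = [set: A] ->
    B z -> C z -> pullback (subspace_incl B) w = 0 ->
    pullback (subspace_incl C) w = 0 -> theta A n k degE w = 0.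
  have vanish := vanishes_below_excess n_gt0 theta_excess.
  (* Only the vanishing of [w] on the cover matters now; forgetting its origin allows [n] to be
     replaced by a successor. *)
  clearbody w; clear - theta_stable w degE n_gt0 vanish.
  case: n n_gt0 w degE vanish => [//|n'] _ w e vanish.
  move=> oB oC BC Bz Cz wB wC; case: k e => [|k'] e.
    exact: (operation_eq0_degree0 theta_stable BC).
  exact: (operation_eq0 theta_stable oB oC BC wB wC vanish
    (exist _ z (mem_set (conj Bz Cz)))).
have [[z [Uz Vz]]|UT|VT] := path_connected_cover a A_pc oU oV UV.
- by apply: (main U V z) => //; exact: w0.
- by apply: (main U U a) => //; rewrite ?setUid ?UT//; rewrite -?UT; exact: w0.
- by apply: (main V V a) => //; rewrite ?setUid ?VT//; rewrite -?VT; exact: w0.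
Qed.
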